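(* There is an absolute constant $C>0$ such that the following holds. Let $G$ be a maximal planar graph with $n\ge 4$ vertices, and consider any planar straight-line drawing of $G$ in the hyperbolic plane. Then the vertex-edge resolution of the drawing is at most $C/\sqrt{n}$.
   Context: The hyperbolic plane is the complete simply connected Riemannian surface of constant curvature $-1$. A planar straight-line hyperbolic drawing of a graph places the vertices at distinct points of the hyperbolic plane and draws each edge as the hyperbolic geodesic segment between its endpoints, so that no two edges intersect except at a common endpoint and no edge passes through a vertex other than its endpoints. The vertex-edge resolution of a drawing is the minimum, over all pairs consisting of a vertex $v$ and an edge $e$ not incident to $v$, of the hyperbolic distance from $v$ to the segment $e$. A maximal planar graph is a planar graph to which no edge can be added while preserving planarity. *)

(* Defs.v *)
From Stdlib Require Import Reals Lra.
From Coquelicot Require Import Coquelicot.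
Open Scope R_scope.

Definition hpoint := (R * R)%type.

Definition acosh (x : R) : R := ln (x + sqrt (x * x - 1)).

Definition kdot (p q : hpoint) : R := fst p * fst q + snd p * snd q.
Definition knorm2 (p : hpoint) : R := kdot p p.

(** The hyperbolic plane, in the Beltrami--Klein model: the open unit disk,
    with cosh d(p,q) = (1 - <p,q>) / sqrt((1-|p|^2)(1-|q|^2)).
    In this model hyperbolic geodesic segments are Euclidean segments. *)
Definition in_klein_disk (p : hpoint) : Prop := knorm2 p < 1.

Definition hdist (p q : hpoint) : R :=
  acosh ((1 - kdot p q) / sqrt ((1 - knorm2 p) * (1 - knorm2 q))).

Definition seg_pt (a b : hpoint) (t : R) : hpoint :=
  ((1 - t) * fst a + t * fst b, (1 - t) * snd a + t * snd b).

Definition on_seg (p a b : hpoint) : Prop :=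
  exists t, 0 <= t <= 1 /\ p = seg_pt a b t.

(** Graphs on vertex set {0,...,n-1}, given by an adjacency relation. *)
Definition graph := nat -> nat -> Prop.

Definition simple_graph (n : nat) (G : graph) : Prop :=
  (forall i j, G i j -> (i < n)%nat /\ (j < n)%nat /\ i <> j) /\
  (forall i j, G i j -> G j i).

Definition same_edge (i j k l : nat) : Prop :=
  (i = k /\ j = l) \/ (i = l /\ j = k).

Definition add_edge (G : graph) (i j : nat) : graph :=
  fun a b => G a b \/ same_edge a b i j.

Definition inj_on_vertices (n : nat) (pos : nat -> hpoint) : Prop :=
  forall u v, (u < n)%nat -> (v < n)%nat -> pos u = pos v -> u = v.

(** A planar embedding in the Euclidean plane R^2: distinct vertex points,
    each edge {i,j} (represented by i < j) a Jordan arc (continuous injective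
    map on [0,1]) from pos i to pos j; distinct edges meet only at endpoints
    of their parametrizations, and no edge passes through a vertex in its
    interior. *)
Definition planar_embedding (n : nat) (G : graph) (pos : nat -> hpoint)
  (curve : nat -> nat -> R -> hpoint) : Prop :=
  inj_on_vertices n pos /\
  (forall i j, G i j -> (i < j)%nat ->
     continuity (fun t => fst (curve i j t)) /\
     continuity (fun t => snd (curve i j t)) /\
     curve i j 0 = pos i /\ curve i j 1 = pos j /\
     (forall s t, 0 <= s <= 1 -> 0 <= t <= 1 -> curve i j s = curve i j t -> s = t)) /\
  (forall i j v s, G i j -> (i < j)%nat -> (v < n)%nat -> 0 < s < 1 ->
     curve i j s <> pos v) /\
  (forall i j k l s t, G i j -> (i < j)%nat -> G k l -> (k < l)%nat ->
     ~ (i = k /\ j = l) -> 0 <= s <= 1 -> 0 <= t <= 1 ->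
     curve i j s = curve k l t -> (s = 0 \/ s = 1) /\ (t = 0 \/ t = 1)).

Definition planar (n : nat) (G : graph) : Prop :=
  exists pos curve, planar_embedding n G pos curve.

Definition maximal_planar (n : nat) (G : graph) : Prop :=
  simple_graph n G /\ planar n G /\
  (forall i j, (i < n)%nat -> (j < n)%nat -> i <> j -> ~ G i j ->
     ~ planar n (add_edge G i j)).

Definition hyp_drawing (n : nat) (G : graph) (pos : nat -> hpoint) : Prop :=
  (forall v, (v < n)%nat -> in_klein_disk (pos v)) /\
  inj_on_vertices n pos /\
  (forall i j k l p, G i j -> G k l -> ~ same_edge i j k l ->
     on_seg p (pos i) (pos j) -> on_seg p (pos k) (pos l) ->
     exists v, (v = i \/ v = j) /\ (v = k \/ v = l) /\ p = pos v) /\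
  (forall i j v, G i j -> (v < n)%nat -> v <> i -> v <> j ->
     ~ on_seg (pos v) (pos i) (pos j)).

Definition dist_to_seg (p a b : hpoint) : R :=
  real (Glb_Rbar (fun d => exists q, on_seg q a b /\ d = hdist p q)).

Definition vertex_edge_resolution (n : nat) (G : graph) (pos : nat -> hpoint) : R :=
  real (Glb_Rbar (fun d => exists v i j, (v < n)%nat /\ G i j /\ v <> i /\ v <> j /\
                        d = dist_to_seg (pos v) (pos i) (pos j))).

(* Main.v *)
Require Import Defs.
From Stdlib Require Import Reals Lra Lia ZArith List Classical.
From Coquelicot Require Import Coquelicot.
Open Scope R_scope.

(* Let r be the resolution.  In the Klein model the drawing is a Euclidean straight-line drawing.
   Two non-adjacent vertices exposed on its convex hull could be joined outside the hull, so by
   maximality the hull vertices are pairwise adjacent; hence there are exactly three of them, and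
   they span a triangle of edges containing all other vertices.  Those are at distance at least r
   from the sides, and from one another: if u and v are distinct, one of them has an edge avoiding
   the other, for otherwise both could be moved outside the hull and joined to it.

   It remains to count.  Enlarge the triangle to an ideal one.  Its null vectors, suitably scaled,
   give coordinates x1, x2, x3 >= 0 with x1 x2 + x2 x3 + x3 x1 = 1/2 and
   cosh d = sum over i <> j of x_i y_j.  In the sector where x3 is largest put s = x1 + x2 <= 1 and
   u = x2 / s in [0,1]; then cosh d - 1 = (s - s')^2 / (2 s s') + s s' (u - u')^2, whose area form
   is proportional to du ds.  As the distance to the ideal sides forces s to be at least of order r,
   a grid of O(1/r^2) cells holds at most one vertex each, so n = O(1/r^2). *)

(** * Counting separated points *)

Definition Rleb (x y : R) : bool := if Rle_dec x y then true else false.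

Lemma Rleb_true (x y : R) : Rleb x y = true <-> x <= y.
Proof. unfold Rleb; destruct (Rle_dec x y); intuition congruence. Qed.

Lemma Rleb_false (x y : R) : negb (Rleb x y) = true <-> y < x.
Proof.
  unfold Rleb; destruct (Rle_dec x y); simpl; split; intros; try congruence; lra.
Qed.

Lemma length_le_1 (l : list nat) :
  NoDup l -> (forall v w, In v l -> In w l -> v = w) -> (length l <= 1)%nat.
Proof.
  intros Hn H; destruct l as [|v [|w l]]; simpl; try lia.
  assert (v = w) by (apply H; simpl; auto).
  inversion Hn as [|? ? Hv]; subst; exfalso; apply Hv; simpl; auto.
Qed.

(** Induction on the number of intervals of length [w]: the topmost one holds at most one point. The
    extra 1 is for the value 0, the only one left when [m = 0]. *)
Lemma separated_1d_nat (u : nat -> R) (w : R) : 0 < w ->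
  forall (m : nat) (l : list nat), NoDup l ->
  (forall v, In v l -> 0 <= u v <= INR m * w) ->
  (forall v v', In v l -> In v' l -> v <> v' -> w < Rabs (u v - u v')) ->
  (length l <= m + 1)%nat.
Proof.
  intros Hw m; induction m as [|m IH]; intros l Hn Hu Hs.
  - apply length_le_1; auto; intros v v' Hv Hv'.
    destruct (Nat.eq_dec v v') as [|Hne]; auto.
    pose proof (Hs _ _ Hv Hv' Hne) as H.
    pose proof (Hu _ Hv); pose proof (Hu _ Hv'); simpl in *.
    replace (u v - u v') with 0 in H by lra; rewrite Rabs_R0 in H; lra.
  - rewrite <- (filter_length (fun v => Rleb (u v) (INR m * w)) l).
    assert (L1 : (length (filter (fun v => Rleb (u v) (INR m * w)) l) <= m + 1)%nat).
    { apply IH; [now apply NoDup_filter| |].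
      - intros v Hv; apply filter_In in Hv; destruct Hv as [Hv Hb].
        apply Rleb_true in Hb; split; [apply Hu|]; auto.
      - intros v v' Hv Hv'; apply filter_In in Hv, Hv'; apply Hs; tauto. }
    assert (L2 : (length (filter (fun v => negb (Rleb (u v) (INR m * w))) l) <= 1)%nat); [|lia].
    apply length_le_1; [now apply NoDup_filter|].
    intros v v' Hv Hv'; apply filter_In in Hv, Hv'.
    destruct Hv as [Hv Hb], Hv' as [Hv' Hb']; apply Rleb_false in Hb, Hb'.
    destruct (Nat.eq_dec v v') as [|Hne]; auto.
    pose proof (Hs _ _ Hv Hv' Hne) as H.
    pose proof (Hu _ Hv) as H1; pose proof (Hu _ Hv') as H2; rewrite S_INR in H1, H2.
    unfold Rabs in H; destruct (Rcase_abs (u v - u v')); nra.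
Qed.

Lemma separated_1d (u : nat -> R) (w : R) (l : list nat) : 0 < w -> NoDup l ->
  (forall v, In v l -> 0 <= u v <= 1) ->
  (forall v v', In v l -> In v' l -> v <> v' -> w < Rabs (u v - u v')) ->
  INR (length l) <= 1 / w + 2.
Proof.
  intros Hw Hn Hu Hs.
  assert (Hi : 0 < 1 / w) by (apply Rdiv_lt_0_compat; lra).
  destruct (archimed (1 / w)) as [H1 H2].
  assert (Hz : (0 <= up (1 / w))%Z) by (apply le_IZR; lra).
  set (m := Z.to_nat (up (1 / w))).
  assert (Hm : INR m = IZR (up (1 / w))) by (unfold m; rewrite INR_IZR_INZ, Z2Nat.id; auto).
  assert (Hl : (length l <= m + 1)%nat).
  { apply (separated_1d_nat u w Hw m l Hn); auto.
    intros v Hv; pose proof (Hu v Hv); rewrite Hm; split; [lra|].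
    assert (1 / w * w = 1) by (field; lra); nra. }
  apply le_INR in Hl; rewrite plus_INR in Hl; simpl in Hl; lra.
Qed.

(* The [s]-layers [q^(i+1) < s <= q^i] with [q = 1/(1+d)] are cut into cells of [u]-width
   [d / (2 q^i)]; each cell holds at most one point, and [s >= d] makes the number of cells
   in a layer at most a multiple of [q^i / d]. *)
Lemma separated_layer (u s : nat -> R) (d Q : R) (l : list nat) :
  0 < d -> d <= Q -> NoDup l ->
  (forall v, In v l -> 0 <= u v <= 1) ->
  (forall v, In v l -> Q < (1 + d) * s v /\ s v <= Q) ->
  (forall v v', In v l -> In v' l -> v <> v' ->
     d * d < (s v - s v')² / (2 * (s v * s v')) + s v * s v' * (u v - u v')²) ->
  INR (length l) <= 4 / d * Q.
Proof.
  intros Hd HQ Hn Hu Hs Hsep.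
  apply Rle_trans with (1 / (d / (2 * Q)) + 2).
  - apply (separated_1d u); auto; [apply Rdiv_lt_0_compat; lra|].
    intros v v' Hv Hv' Hne.
    apply Rnot_le_lt; intros Hle; pose proof (Hsep v v' Hv Hv' Hne) as H.
    destruct (Hs v Hv) as [H1 H2]; destruct (Hs v' Hv') as [H3 H4]; clear Hsep Hs.
    assert (P1 : 0 < s v) by nra.
    assert (P2 : 0 < s v') by nra.
    assert (P3 : 0 < s v * s v') by nra.
    (* Within a layer the two values of [s] differ by a factor at most [1 + d], so their difference
       is at most [d] times the smaller one. *)
    assert (A1 : (s v - s v')² / (2 * (s v * s v')) <= d * d / 2).
    { apply Rmult_le_reg_r with (2 * (s v * s v')); [lra|].
      replace ((s v - s v')² / (2 * (s v * s v')) * (2 * (s v * s v')))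
        with ((s v - s v')²) by (field; lra).
      replace (d * d / 2 * (2 * (s v * s v'))) with (d * d * (s v * s v')) by field.
      unfold Rsqr; destruct (Rle_dec (s v) (s v')).
      - assert (s v' - s v <= d * s v) by nra.
        assert ((s v' - s v) * (s v' - s v) <= d * s v * (d * s v)) by nra.
        assert (d * d * (s v * s v) <= d * d * (s v * s v')) by (apply Rmult_le_compat_l; nra).
        nra.
      - assert (s v - s v' <= d * s v') by nra.
        assert ((s v - s v') * (s v - s v') <= d * s v' * (d * s v')) by nra.
        assert (d * d * (s v' * s v') <= d * d * (s v * s v')) by (apply Rmult_le_compat_l; nra).
        nra. }
    (* Points closer than a cell width [d / (2 Q)] in [u], with [s <= Q]. With [A1] the separation
       would be at most [3/4 d^2], which is excluded. *)
    assert (A2 : s v * s v' * (u v - u v')² <= d * d / 4).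
    { rewrite (Rsqr_abs (u v - u v')).
      apply Rle_trans with (Q * Q * (d / (2 * Q))²).
      - apply Rmult_le_compat; [lra|apply Rle_0_sqr|nra|].
        apply Rsqr_incr_1; auto; [apply Rabs_pos|apply Rlt_le, Rdiv_lt_0_compat; lra].
      - right; unfold Rsqr; field; lra. }
    nra.
  - replace (1 / (d / (2 * Q))) with (2 * Q / d) by (field; lra).
    (* The additive 2 of [separated_1d] is absorbed because [d <= Q]. *)
    assert (1 <= Q / d).
    { apply Rmult_le_reg_r with d; auto; replace (Q / d * d) with Q by (field; lra); lra. }
    replace (4 / d * Q) with (2 * Q / d + 2 * (Q / d)) by (field; lra); lra.
Qed.

(** The bound is the geometric sum of [4 / d * q ^ i] over [i < m], where
    [1 / (1 - q) = (1 + d) / d]. The induction peels off the lowest layer. *)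
Lemma separated_layers (u s : nat -> R) (d : R) : 0 < d ->
  forall (m : nat) (l : list nat), NoDup l ->
  (forall v, In v l -> 0 <= u v <= 1) ->
  (forall v, In v l -> d <= s v /\ (/ (1 + d)) ^ m < s v /\ s v <= 1) ->
  (forall v v', In v l -> In v' l -> v <> v' ->
     d * d < (s v - s v')² / (2 * (s v * s v')) + s v * s v' * (u v - u v')²) ->
  INR (length l) <= 4 / d * ((1 + d) / d) * (1 - (/ (1 + d)) ^ m).
Proof.
  intros Hd m; induction m as [|m IH]; intros l Hn Hu Hs Hsep.
  - destruct l as [|v l]; simpl; [right; ring|].
    destruct (Hs v (or_introl eq_refl)) as [_ [H1 H2]]; simpl in H1; lra.
  - set (q := / (1 + d)) in *.
    rewrite <- (filter_length (fun v => Rleb (s v) (q ^ m)) l), plus_INR.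
    set (l1 := filter (fun v => Rleb (s v) (q ^ m)) l).
    set (l2 := filter (fun v => negb (Rleb (s v) (q ^ m))) l).
    assert (Hl1 : forall v, In v l1 -> In v l /\ s v <= q ^ m).
    { intros v Hv; apply filter_In in Hv; rewrite Rleb_true in Hv; auto. }
    assert (Hl2 : forall v, In v l2 -> In v l /\ q ^ m < s v).
    { intros v Hv; apply filter_In in Hv; rewrite Rleb_false in Hv; auto. }
    assert (B2 : INR (length l2) <= 4 / d * ((1 + d) / d) * (1 - q ^ m)).
    { apply IH; [now apply NoDup_filter| | |].
      - intros v Hv; apply Hu; apply Hl2; auto.
      - intros v Hv; destruct (Hl2 v Hv) as [Hv1 Hv2]; destruct (Hs v Hv1) as [? [? ?]]; auto.
      - intros v v' Hv Hv'; apply Hsep; apply Hl2; auto. }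
    assert (Hq : q * (1 + d) = 1) by (unfold q; field; lra).
    assert (B1 : INR (length l1) <= 4 / d * q ^ m).
    (* An empty layer is treated apart: [d <= q ^ m] is read off from a point [v0] of the layer,
       since [d <= s v0 <= q ^ m]. *)
    { destruct l1 as [|v0 l1'] eqn:E.
      - simpl; apply Rmult_le_pos.
        + apply Rlt_le, Rdiv_lt_0_compat; lra.
        + apply pow_le; nra.
      - rewrite <- E in *; apply (separated_layer u s d (q ^ m)); auto.
        + destruct (Hl1 v0) as [H1 H2]; [rewrite E; simpl; auto|].
          destruct (Hs v0 H1) as [? _]; lra.
        + unfold l1; now apply NoDup_filter.
        + intros v Hv; apply Hu; apply Hl1; auto.
        + intros v Hv; destruct (Hl1 v Hv) as [Hv1 Hv2].
          destruct (Hs v Hv1) as [_ [H1 _]]; split; auto.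
          simpl in H1; replace (q ^ m) with ((1 + d) * (q * q ^ m)).
          * apply Rmult_lt_compat_l; lra.
          * rewrite <- Rmult_assoc, (Rmult_comm (1 + d)), Hq; ring.
        + intros v v' Hv Hv'; apply Hsep; apply Hl1; auto. }
    replace (4 / d * ((1 + d) / d) * (1 - q ^ S m))
      with (4 / d * q ^ m + 4 / d * ((1 + d) / d) * (1 - q ^ m)); [lra|].
    simpl; unfold q; field; split; try lra.
Qed.

(** Finitely many layers suffice, since [q ^ m < d <= s] for some [m]. If there is a point at all,
    then [d <= 1], and the geometric sum is at most [4 / d * (2 / d)]. *)
Lemma separated_count (u s : nat -> R) (d : R) (l : list nat) : 0 < d -> NoDup l ->
  (forall v, In v l -> 0 <= u v <= 1) ->
  (forall v, In v l -> d <= s v <= 1) ->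
  (forall v v', In v l -> In v' l -> v <> v' ->
     d * d < (s v - s v')² / (2 * (s v * s v')) + s v * s v' * (u v - u v')²) ->
  INR (length l) <= 8 / (d * d).
Proof.
  intros Hd Hn Hu Hs Hsep.
  destruct l as [|v0 l0] eqn:E; [simpl; apply Rlt_le, Rdiv_lt_0_compat; nra|].
  rewrite <- E in *.
  assert (Hd1 : d <= 1) by (destruct (Hs v0); [rewrite E; simpl; auto|lra]).
  assert (Hq0 : 0 < / (1 + d)) by (apply Rinv_0_lt_compat; lra).
  assert (Hq : Rabs (/ (1 + d)) < 1).
  { rewrite Rabs_pos_eq by lra; rewrite <- Rinv_1; apply Rinv_lt_contravar; lra. }
  destruct (pow_lt_1_zero _ Hq d Hd) as [m Hm].
  specialize (Hm m (le_n m)).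
  rewrite Rabs_pos_eq in Hm by (apply pow_le; lra).
  eapply Rle_trans; [apply (separated_layers u s d Hd m l); auto|].
  - intros v Hv; destruct (Hs v Hv); repeat split; lra.
  - replace (8 / (d * d)) with (4 / d * (2 / d) * 1) by (field; lra).
    assert (H1 : 0 < (/ (1 + d)) ^ m) by (apply pow_lt; lra).
    assert (0 < 4 / d) by (apply Rdiv_lt_0_compat; lra).
    assert (0 < (1 + d) / d) by (apply Rdiv_lt_0_compat; lra).
    assert ((1 + d) / d <= 2 / d).
    { apply Rmult_le_compat_r; [apply Rlt_le, Rinv_0_lt_compat|]; lra. }
    apply Rmult_le_compat; try lra; [nra| ].
    apply Rmult_le_compat_l; lra.
Qed.

(** * Klein segments and barycentric coordinates *)

Lemma acosh_mono (x y : R) : 1 <= x <= y -> acosh x <= acosh y.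
Proof.
  intros H; unfold acosh.
  assert (sqrt (x * x - 1) <= sqrt (y * y - 1)) by (apply sqrt_le_1_alt; nra).
  pose proof (sqrt_pos (x * x - 1)).
  apply ln_le; lra.
Qed.

(** From [ln x <= x - 1]. *)
Lemma acosh_1_plus_le (e : R) : 0 <= e -> acosh (1 + e) <= e + sqrt (2 * e + e * e).
Proof.
  intros He; unfold acosh.
  replace ((1 + e) * (1 + e) - 1) with (2 * e + e * e) by ring.
  pose proof (sqrt_pos (2 * e + e * e)).
  set (z := sqrt (2 * e + e * e)) in *.
  rewrite <- (ln_exp (e + z)); apply ln_le; [lra|].
  pose proof (exp_ineq1_le (e + z)); lra.
Qed.

Lemma kdot_lt_1 (p q : hpoint) : in_klein_disk p -> in_klein_disk q -> kdot p q < 1.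
Proof.
  destruct p as [p1 p2], q as [q1 q2]; unfold in_klein_disk, knorm2, kdot; simpl; intros.
  pose proof (Rle_0_sqr (p1 - q1)); pose proof (Rle_0_sqr (p2 - q2)); unfold Rsqr in *; lra.
Qed.

Lemma klein_disk_seg (p q : hpoint) (t : R) :
  in_klein_disk p -> in_klein_disk q -> 0 <= t <= 1 -> in_klein_disk (seg_pt p q t).
Proof.
  intros Hp Hq Ht; pose proof (kdot_lt_1 p q Hp Hq).
  unfold in_klein_disk in *.
  assert (E : knorm2 (seg_pt p q t) =
    (1 - t) * (1 - t) * knorm2 p + 2 * t * (1 - t) * kdot p q + t * t * knorm2 q).
  { unfold knorm2, kdot, seg_pt; simpl; ring. }
  rewrite E.
  assert (0 <= (1 - t) * (1 - t)) by nra.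
  assert (0 <= t * (1 - t)) by nra.
  assert (0 <= t * t) by nra.
  destruct (Req_dec t 0) as [->|]; [lra|].
  assert (0 < t * t) by nra.
  nra.
Qed.

Lemma div_sqrt_le (a b c d : R) : 0 <= a -> 0 <= c -> 0 < b -> 0 < d ->
  a * a * d <= c * c * b -> a / sqrt b <= c / sqrt d.
Proof.
  intros Ha Hc Hb Hd H.
  pose proof (sqrt_lt_R0 b Hb); pose proof (sqrt_lt_R0 d Hd).
  apply Rmult_le_reg_r with (sqrt b * sqrt d); [nra|].
  replace (a / sqrt b * (sqrt b * sqrt d)) with (a * sqrt d) by (field; lra).
  replace (c / sqrt d * (sqrt b * sqrt d)) with (c * sqrt b) by (field; lra).
  apply Rsqr_incr_0; try nra.
  rewrite !Rsqr_mult, !Rsqr_sqrt by lra; unfold Rsqr; lra.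
Qed.

(** With [A], [B], [D] the values of [1 - |.|^2] at [p], at [q] and at the point of parameter [t],
    the squared hyperbolic cosine of the distance to that point is [1 + t^2 K / (A D)], where [K]
    does not depend on [t]. Monotonicity then reduces to [t^2 B <= D], which is concavity of
    [1 - |.|^2] along the segment in a sharpened form. *)
Lemma hdist_seg_le (p q : hpoint) (t : R) : in_klein_disk p -> in_klein_disk q ->
  0 <= t <= 1 -> hdist p (seg_pt p q t) <= hdist p q.
Proof.
  intros Hp Hq Ht; pose proof (klein_disk_seg p q t Hp Hq Ht) as Hs.
  pose proof (kdot_lt_1 p q Hp Hq) as H1; pose proof (kdot_lt_1 _ _ Hp Hs) as Ht1.
  unfold in_klein_disk in *.
  set (K := (kdot p q - knorm2 p) * (kdot p q - knorm2 p) +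
            (1 - knorm2 p) * (knorm2 q - 2 * kdot p q + knorm2 p)).
  assert (HK : 0 <= K).
  { assert (0 <= knorm2 q - 2 * kdot p q + knorm2 p).
    { unfold knorm2, kdot; destruct p as [p1 p2], q as [q1 q2]; simpl.
      pose proof (Rle_0_sqr (p1 - q1)); pose proof (Rle_0_sqr (p2 - q2)); unfold Rsqr in *; lra. }
    unfold K; apply Rplus_le_le_0_compat; [apply Rle_0_sqr|apply Rmult_le_pos; lra]. }
  assert (Et : (1 - kdot p (seg_pt p q t)) * (1 - kdot p (seg_pt p q t)) =
    (1 - knorm2 p) * (1 - knorm2 (seg_pt p q t)) + t * t * K).
  { unfold K, knorm2, kdot, seg_pt; simpl; ring. }
  assert (E1 : (1 - kdot p q) * (1 - kdot p q) = (1 - knorm2 p) * (1 - knorm2 q) + K).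
  { unfold K, knorm2, kdot; simpl; ring. }
  assert (EN : knorm2 (seg_pt p q t) = knorm2 p * ((1 - t) * (1 - t)) +
     2 * t * (1 - t) * kdot p q + t * t * knorm2 q).
  { unfold knorm2, kdot, seg_pt; simpl; ring. }
  assert (Hc : t * t * (1 - knorm2 q) <= 1 - knorm2 (seg_pt p q t)).
  { rewrite EN.
    assert (0 <= (1 - t) * (1 - t) * (1 - knorm2 p)) by (apply Rmult_le_pos; nra).
    assert (0 <= t * (1 - t) * (1 - kdot p q)) by (apply Rmult_le_pos; nra).
    nra. }
  set (A := 1 - knorm2 p) in *; set (B := 1 - knorm2 q) in *.
  set (D := 1 - knorm2 (seg_pt p q t)) in *.
  assert (0 < A) by (unfold A; lra).
  assert (0 < B) by (unfold B; lra).
  assert (0 < D) by (unfold D; lra).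
  assert (0 < A * D) by (apply Rmult_lt_0_compat; lra).
  assert (0 < A * B) by (apply Rmult_lt_0_compat; lra).
  unfold hdist; fold A B D; apply acosh_mono; split.
  - replace 1 with (1 / sqrt 1) at 1 by (rewrite sqrt_1; field).
    apply div_sqrt_le; try lra.
    rewrite Et; assert (0 <= t * t * K) by (apply Rmult_le_pos; nra); lra.
  - apply div_sqrt_le; try lra.
    rewrite Et, E1.
    assert (t * t * B * K <= D * K) by (apply Rmult_le_compat_r; auto).
    assert (A * (t * t * B * K) <= A * (D * K)) by (apply Rmult_le_compat_l; lra).
    nra.
Qed.

(** Twice the signed area of the triangle. *)
Definition det3 (a b c : hpoint) : R :=
  (fst b - fst a) * (snd c - snd a) - (snd b - snd a) * (fst c - fst a).

(** Only the weight of the first vertex is defined; the other two weights are obtained by rotating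
    the arguments, so that every lemma about one side serves all three. *)
Definition bary (a b c p : hpoint) : R := det3 p b c / det3 a b c.

Definition in_triangle (a b c p : hpoint) : Prop :=
  0 <= bary a b c p /\ 0 <= bary b c a p /\ 0 <= bary c a b p.

Lemma det3_rot (a b c : hpoint) : det3 b c a = det3 a b c.
Proof. unfold det3; ring. Qed.

Lemma bary_sum (a b c p : hpoint) : det3 a b c <> 0 ->
  bary a b c p + bary b c a p + bary c a b p = 1.
Proof.
  intros H; unfold bary; rewrite (det3_rot b c a), (det3_rot a b c).
  rewrite <- Rdiv_plus_distr, <- Rdiv_plus_distr.
  apply Rmult_eq_reg_r with (det3 a b c); auto.
  unfold Rdiv; rewrite Rmult_assoc, Rinv_l by auto; unfold det3; ring.
Qed.

Lemma bary_fst (a b c p : hpoint) : det3 a b c <> 0 ->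
  fst p = bary a b c p * fst a + bary b c a p * fst b + bary c a b p * fst c.
Proof.
  intros H; unfold bary; rewrite (det3_rot b c a), (det3_rot a b c).
  apply Rmult_eq_reg_r with (det3 a b c); auto.
  unfold Rdiv; rewrite !Rmult_plus_distr_r.
  replace (det3 p b c * / det3 a b c * fst a * det3 a b c) with (det3 p b c * fst a) by (field; auto).
  replace (det3 p c a * / det3 a b c * fst b * det3 a b c) with (det3 p c a * fst b) by (field; auto).
  replace (det3 p a b * / det3 a b c * fst c * det3 a b c) with (det3 p a b * fst c) by (field; auto).
  unfold det3; ring.
Qed.

Lemma bary_snd (a b c p : hpoint) : det3 a b c <> 0 ->
  snd p = bary a b c p * snd a + bary b c a p * snd b + bary c a b p * snd c.
Proof.
  intros H; unfold bary; rewrite (det3_rot b c a), (det3_rot a b c).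
  apply Rmult_eq_reg_r with (det3 a b c); auto.
  unfold Rdiv; rewrite !Rmult_plus_distr_r.
  replace (det3 p b c * / det3 a b c * snd a * det3 a b c) with (det3 p b c * snd a) by (field; auto).
  replace (det3 p c a * / det3 a b c * snd b * det3 a b c) with (det3 p c a * snd b) by (field; auto).
  replace (det3 p a b * / det3 a b c * snd c * det3 a b c) with (det3 p a b * snd c) by (field; auto).
  unfold det3; ring.
Qed.

(** [det3] is affine in its first argument. *)
Lemma bary_comb3 (a b c x y z p : hpoint) (l1 l2 l3 : R) : l1 + l2 + l3 = 1 ->
  fst p = l1 * fst x + l2 * fst y + l3 * fst z ->
  snd p = l1 * snd x + l2 * snd y + l3 * snd z ->
  bary a b c p = l1 * bary a b c x + l2 * bary a b c y + l3 * bary a b c z.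
Proof.
  intros Hl H1 H2.
  assert (E : det3 p b c = l1 * det3 x b c + l2 * det3 y b c + l3 * det3 z b c).
  { unfold det3; rewrite H1, H2; replace l3 with (1 - l1 - l2) by lra; ring. }
  unfold bary; rewrite E; unfold Rdiv; ring.
Qed.

Lemma bary_seg (a b c p q : hpoint) (t : R) :
  bary a b c (seg_pt p q t) = (1 - t) * bary a b c p + t * bary a b c q.
Proof.
  rewrite (bary_comb3 a b c p q q (seg_pt p q t) (1 - t) t 0); [ring|ring| |];
  unfold seg_pt; simpl; ring.
Qed.

Lemma bary_change (a b c x y z p : hpoint) : det3 x y z <> 0 ->
  bary a b c p = bary x y z p * bary a b c x + bary y z x p * bary a b c y
                 + bary z x y p * bary a b c z.
Proof.
  intros H; apply bary_comb3; [apply bary_sum|apply bary_fst|apply bary_snd]; auto.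
Qed.

Lemma bary_zero_on_seg (a b c p : hpoint) : det3 a b c <> 0 -> in_triangle a b c p ->
  bary a b c p = 0 -> on_seg p b c.
Proof.
  intros Hd (H1 & H2 & H3) H0.
  pose proof (bary_sum a b c p Hd) as Hs.
  pose proof (bary_fst a b c p Hd) as Hf; pose proof (bary_snd a b c p Hd) as Hg.
  rewrite H0 in *.
  exists (bary c a b p); split; [lra|].
  replace (bary b c a p) with (1 - bary c a b p) in * by lra.
  set (t := bary c a b p) in *; clearbody t.
  destruct p as [p1 p2]; unfold seg_pt; simpl in *; f_equal; lra.
Qed.

Lemma affine_exit_step (a b T : R) : 0 <= a -> 0 <= T ->
  exists T', 0 <= T' <= T /\ 0 <= (1 - T') * a + T' * b /\
    (T' = T \/ (1 - T') * a + T' * b = 0).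
Proof.
  intros Ha HT; destruct (Rle_dec 0 ((1 - T) * a + T * b)) as [H|H].
  - exists T; repeat split; auto; lra.
  - assert (Hb : 0 < a - b) by (destruct (Rle_dec b 0); nra).
    assert (E : (1 - a / (a - b)) * a + a / (a - b) * b = 0) by (field; lra).
    exists (a / (a - b)); split; [|split; [right; symmetry|right]; exact E].
    split; [apply Rmult_le_pos; [|apply Rlt_le, Rinv_0_lt_compat]; lra|].
    apply Rmult_le_reg_r with (a - b); auto.
    replace (a / (a - b) * (a - b)) with a by (field; lra); nra.
Qed.

Lemma affine_between (a b T T' : R) : 0 <= a -> 0 <= T' <= T ->
  0 <= (1 - T) * a + T * b -> 0 <= (1 - T') * a + T' * b.
Proof.
  intros Ha HT H; destruct (Req_dec T 0) as [->|HT0].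
  - replace T' with 0 by lra; lra.
  - destruct (Rle_dec 0 b); [|nra].
    destruct (Rle_dec T' 1); [nra|].
    assert (HTT : 0 < T) by lra.
    assert (0 <= T' * ((1 - T) * a + T * b)) by (apply Rmult_le_pos; lra).
    assert (0 <= (T - T') * a) by (apply Rmult_le_pos; lra).
    assert (0 <= T * ((1 - T') * a + T' * b)) by nra.
    nra.
Qed.

(** The interval of parameters is clipped by the three functions in turn. Each clipping keeps the
    earlier functions nonnegative, and the last one to shorten the interval vanishes at its end;
    [b1 <= 0] makes the first function vanish there if no later one shortens it. *)
Lemma affine_exit (a1 b1 a2 b2 a3 b3 : R) :
  0 <= a1 -> 0 <= a2 -> 0 <= a3 -> b1 <= 0 ->
  exists t, 0 <= t <= 1 /\
    0 <= (1 - t) * a1 + t * b1 /\ 0 <= (1 - t) * a2 + t * b2 /\ 0 <= (1 - t) * a3 + t * b3 /\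
    ((1 - t) * a1 + t * b1 = 0 \/ (1 - t) * a2 + t * b2 = 0 \/ (1 - t) * a3 + t * b3 = 0).
Proof.
  intros H1 H2 H3 Hb.
  assert (exists t1, 0 <= t1 <= 1 /\ (1 - t1) * a1 + t1 * b1 = 0) as [t1 [Ht1 E1]].
  { destruct (affine_exit_step a1 b1 1) as (t & Ht & H & [E|E]); try lra.
    - exists 1; split; [lra|]; subst t; lra.
    - exists t; split; auto. }
  destruct (affine_exit_step a2 b2 t1) as (t2 & Ht2 & P2 & E2); try lra.
  destruct (affine_exit_step a3 b3 t2) as (t3 & Ht3 & P3 & E3); try lra.
  exists t3; split; [lra|]; split; [|split; [|split]].
  - apply affine_between with t1; lra.
  - apply affine_between with t2; auto; lra.
  - auto.
  - destruct E3 as [->|E3]; auto.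
    destruct E2 as [->|E2]; auto.
Qed.

Definition on_triangle_boundary (a b c x : hpoint) : Prop :=
  on_seg x a b \/ on_seg x b c \/ on_seg x c a.

Lemma triangle_exit_1 (a b c p q : hpoint) : det3 a b c <> 0 -> in_triangle a b c p ->
  bary a b c q <= 0 ->
  exists t, 0 <= t <= 1 /\ on_triangle_boundary a b c (seg_pt p q t).
Proof.
  intros Hd (H1 & H2 & H3) Hq.
  destruct (affine_exit _ _ _ (bary b c a q) _ (bary c a b q) H1 H2 H3 Hq)
    as (t & Ht & P1 & P2 & P3 & E).
  rewrite <- !bary_seg in *.
  exists t; split; auto; unfold on_triangle_boundary.
  destruct E as [E|[E|E]].
  - right; left; apply (bary_zero_on_seg a b c); auto; repeat split; auto.
  - right; right; apply (bary_zero_on_seg b c a); auto; [now rewrite det3_rot|repeat split; auto].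
  - left; apply (bary_zero_on_seg c a b); auto; [now rewrite 2!det3_rot|repeat split; auto].
Qed.

Lemma triangle_exit (a b c p q : hpoint) : det3 a b c <> 0 -> in_triangle a b c p ->
  (bary a b c q <= 0 \/ bary b c a q <= 0 \/ bary c a b q <= 0) ->
  exists t, 0 <= t <= 1 /\ on_triangle_boundary a b c (seg_pt p q t).
Proof.
  intros Hd Hp [Hq|[Hq|Hq]].
  - apply triangle_exit_1; auto.
  - destruct Hp as (H1 & H2 & H3).
    destruct (triangle_exit_1 b c a p q) as (t & Ht & H); auto;
      [now rewrite det3_rot|repeat split; auto|].
    exists t; split; auto; unfold on_triangle_boundary in *; tauto.
  - destruct Hp as (H1 & H2 & H3).
    destruct (triangle_exit_1 c a b p q) as (t & Ht & H); auto;
      [now rewrite 2!det3_rot|repeat split; auto|].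
    exists t; split; auto; unfold on_triangle_boundary in *; tauto.
Qed.

(** The exit point is [p + k (q - p)], with [k] the positive root of [E k^2 + 2 B k = c]. Since [q]
    is inside, [2 B + E < c], which forces [k >= 1]; then [t = 1 / k]. *)
Lemma ray_exit (p q : hpoint) : in_klein_disk p -> in_klein_disk q -> p <> q ->
  exists (x : hpoint) (t : R), knorm2 x = 1 /\ 0 < t <= 1 /\ q = seg_pt p x t.
Proof.
  destruct p as [p1 p2], q as [q1 q2]; unfold in_klein_disk, knorm2, kdot; simpl.
  intros Hp Hq Hne.
  set (e1 := q1 - p1); set (e2 := q2 - p2).
  set (E := e1 * e1 + e2 * e2); set (B := p1 * e1 + p2 * e2); set (c := 1 - (p1 * p1 + p2 * p2)).
  assert (HE : 0 < E).
  { unfold E; destruct (Req_dec e1 0) as [H1|H1]; [|nra].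
    destruct (Req_dec e2 0) as [H2|H2]; [|nra].
    exfalso; apply Hne; unfold e1, e2 in *; f_equal; lra. }
  assert (Hc : 0 < c) by (unfold c; lra).
  assert (HBE : 2 * B + E < c).
  { unfold B, E, c, e1, e2 in *; nra. }
  set (r := sqrt (B * B + E * c)).
  assert (Hr : r * r = B * B + E * c) by (apply sqrt_sqrt; nra).
  assert (Hr0 : 0 <= r) by apply sqrt_pos.
  assert (Hrb : B + E <= r).
  { destruct (Rle_dec (B + E) 0); [lra|]. apply Rnot_lt_le; intros H; nra. }
  set (k := (r - B) / E).
  assert (HkE : k * E = r - B) by (unfold k; field; lra).
  assert (Hk : 1 <= k) by nra.
  assert (Hk2 : E * (k * k) + 2 * B * k = c).
  { apply Rmult_eq_reg_r with E; [|lra].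
    replace ((E * (k * k) + 2 * B * k) * E) with (k * E * (k * E) + 2 * B * (k * E)) by ring.
    rewrite HkE; nra. }
  exists (p1 + k * e1, p2 + k * e2), (/ k); simpl; split; [|split].
  - unfold E, B, c in Hk2; nra.
  - split; [apply Rinv_0_lt_compat; lra|].
    rewrite <- Rinv_1; apply Rinv_le_contravar; lra.
  - unfold seg_pt; simpl; unfold e1, e2; f_equal; field; lra.
Qed.

(** * Ideal triangles *)

Definition ideal_triangle (a b c : hpoint) : Prop :=
  knorm2 a = 1 /\ knorm2 b = 1 /\ knorm2 c = 1 /\ det3 a b c <> 0.

Lemma ideal_triangle_rot (a b c : hpoint) : ideal_triangle a b c -> ideal_triangle b c a.
Proof. unfold ideal_triangle; rewrite (det3_rot a b c); tauto. Qed.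

Lemma in_triangle_rot (a b c p : hpoint) : in_triangle a b c p -> in_triangle b c a p.
Proof. unfold in_triangle; tauto. Qed.

(* Each side is prolonged in cyclic order until it hits the circle. *)
Lemma ideal_triangle_exists (a b c : hpoint) :
  in_klein_disk a -> in_klein_disk b -> in_klein_disk c -> det3 a b c <> 0 ->
  exists x y z, ideal_triangle x y z /\
    in_triangle x y z a /\ in_triangle x y z b /\ in_triangle x y z c.
Proof.
  intros Ha Hb Hc Hd.
  destruct (ray_exit a b Ha Hb) as (x & t1 & Hx & Ht1 & Eb).
  { intros ->; apply Hd; unfold det3; ring. }
  destruct (ray_exit b c Hb Hc) as (y & t2 & Hy & Ht2 & Ec).
  { intros ->; apply Hd; unfold det3; ring. }
  destruct (ray_exit c a Hc Ha) as (z & t3 & Hz & Ht3 & Ea).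
  { intros ->; apply Hd; unfold det3; ring. }
  (* Substituting [b] into [c] and [c] into [a] expresses [a] through [x], [y], [z] and itself, the
     latter with weight [k]. Solving for [a] gives the weights [m1], [m2], [m3]. *)
  set (k := (1 - t1) * (1 - t2) * (1 - t3)).
  assert (Hk : 0 <= k < 1).
  { unfold k; split; [apply Rmult_le_pos; [apply Rmult_le_pos|]; lra|].
    assert (0 <= (1 - t1) * (1 - t2) <= 1 - t1) by nra. nra. }
  set (m1 := (1 - t3) * (1 - t2) * t1 / (1 - k)).
  set (m2 := (1 - t3) * t2 / (1 - k)).
  set (m3 := t3 / (1 - k)).
  assert (Hi : 0 < / (1 - k)) by (apply Rinv_0_lt_compat; lra).
  assert (Hm1 : 0 <= m1) by (apply Rmult_le_pos; [repeat apply Rmult_le_pos|]; lra).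
  assert (Hm2 : 0 <= m2) by (apply Rmult_le_pos; [repeat apply Rmult_le_pos|]; lra).
  assert (Hm3 : 0 <= m3) by (apply Rmult_le_pos; lra).
  assert (Hm : m1 + m2 + m3 = 1).
  { unfold m1, m2, m3; apply Rmult_eq_reg_r with (1 - k); [|lra].
    unfold Rdiv; rewrite !Rmult_plus_distr_r, !Rmult_assoc, Rinv_l by lra; unfold k; ring. }
  assert (Hfa : forall f : hpoint -> R,
    (forall p q t, f (seg_pt p q t) = (1 - t) * f p + t * f q) ->
    f a = m1 * f x + m2 * f y + m3 * f z).
  { intros f Hf.
    assert (E1 : f b = (1 - t1) * f a + t1 * f x) by (rewrite Eb at 1; apply Hf).
    assert (E2 : f c = (1 - t2) * f b + t2 * f y) by (rewrite Ec at 1; apply Hf).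
    assert (E3 : f a = (1 - t3) * f c + t3 * f z) by (rewrite Ea at 1; apply Hf).
    apply Rmult_eq_reg_r with (1 - k); [|lra].
    unfold m1, m2, m3, Rdiv; rewrite !Rmult_plus_distr_r.
    replace ((1 - t3) * (1 - t2) * t1 * / (1 - k) * f x * (1 - k))
      with ((1 - t3) * (1 - t2) * t1 * f x) by (field; lra).
    replace ((1 - t3) * t2 * / (1 - k) * f y * (1 - k))
      with ((1 - t3) * t2 * f y) by (field; lra).
    replace (t3 * / (1 - k) * f z * (1 - k)) with (t3 * f z) by (field; lra).
    rewrite E2, E1 in E3; unfold k; lra. }
  assert (Fa : fst a = m1 * fst x + m2 * fst y + m3 * fst z) by (apply Hfa; reflexivity).
  assert (Sa : snd a = m1 * snd x + m2 * snd y + m3 * snd z) by (apply Hfa; reflexivity).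
  (* [det3 a b c = t1 t2 m3 det3 x y z], so the ideal triangle inherits nondegeneracy. *)
  assert (HD : det3 x y z <> 0).
  { intros H0; apply Hd.
    assert (E : det3 a b c = t1 * t2 * det3 a x y).
    { rewrite Ec, Eb; unfold det3, seg_pt; simpl; ring. }
    assert (E' : det3 a x y = m3 * det3 x y z).
    { unfold det3; rewrite Fa, Sa; replace m3 with (1 - m1 - m2) by lra; ring. }
    rewrite E, E', H0; ring. }
  assert (Hself : bary x y z x = 1 /\ bary x y z y = 0 /\ bary x y z z = 0 /\
                  bary y z x x = 0 /\ bary y z x y = 1 /\ bary y z x z = 0 /\
                  bary z x y x = 0 /\ bary z x y y = 0 /\ bary z x y z = 1).
  { unfold bary; rewrite (det3_rot y z x), (det3_rot x y z).
    repeat split; apply Rmult_eq_reg_r with (det3 x y z); auto;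
    unfold Rdiv; rewrite ?Rmult_assoc, ?Rinv_l by auto; unfold det3; ring. }
  destruct Hself as (S1 & S2 & S3 & S4 & S5 & S6 & S7 & S8 & S9).
  assert (Ta : in_triangle x y z a).
  { unfold in_triangle.
    rewrite (bary_comb3 x y z x y z a m1 m2 m3 Hm Fa Sa), (bary_comb3 y z x x y z a m1 m2 m3 Hm Fa Sa),
      (bary_comb3 z x y x y z a m1 m2 m3 Hm Fa Sa).
    rewrite S1, S2, S3, S4, S5, S6, S7, S8, S9; lra. }
  assert (Tb : in_triangle x y z b).
  { destruct Ta as (T1 & T2 & T3); unfold in_triangle; rewrite Eb, !bary_seg.
    rewrite S1, S4, S7; repeat split; nra. }
  assert (Tc : in_triangle x y z c).
  { destruct Tb as (T1 & T2 & T3); unfold in_triangle; rewrite Ec, !bary_seg.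
    rewrite S2, S5, S8; repeat split; nra. }
  exists x, y, z; split; [repeat split|]; auto.
Qed.

Lemma in_triangle_trans (x y z a b c p : hpoint) : det3 a b c <> 0 ->
  in_triangle x y z a -> in_triangle x y z b -> in_triangle x y z c ->
  in_triangle a b c p -> in_triangle x y z p.
Proof.
  intros Hd (A1 & A2 & A3) (B1 & B2 & B3) (C1 & C2 & C3) (P1 & P2 & P3).
  unfold in_triangle.
  rewrite (bary_change x y z a b c p Hd), (bary_change y z x a b c p Hd),
    (bary_change z x y a b c p Hd).
  repeat split; repeat apply Rplus_le_le_0_compat; apply Rmult_le_pos; auto.
Qed.

(** The inner triangle lies on one side of the line [y z]. A point of this line strictly inside
    [a b c] would put all three vertices on the line, making [det3 a b c] vanish. *)
Lemma bary_zero_outside (x y z a b c q : hpoint) : det3 x y z <> 0 -> det3 a b c <> 0 ->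
  in_triangle x y z a -> in_triangle x y z b -> in_triangle x y z c ->
  bary x y z q = 0 -> bary a b c q <= 0 \/ bary b c a q <= 0 \/ bary c a b q <= 0.
Proof.
  intros Hx Hd (A1 & _) (B1 & _) (C1 & _) Hq.
  destruct (Rle_dec (bary a b c q) 0) as [|N1]; auto.
  destruct (Rle_dec (bary b c a q) 0) as [|N2]; auto.
  destruct (Rle_dec (bary c a b q) 0) as [|N3]; auto.
  exfalso; apply Hd.
  rewrite (bary_change x y z a b c q Hd) in Hq.
  assert (Za : bary x y z a = 0) by nra.
  assert (Zb : bary x y z b = 0) by nra.
  assert (Zc : bary x y z c = 0) by nra.
  pose proof (bary_fst x y z a Hx) as Fa; pose proof (bary_snd x y z a Hx) as Sa.
  pose proof (bary_fst x y z b Hx) as Fb; pose proof (bary_snd x y z b Hx) as Sb.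
  pose proof (bary_fst x y z c Hx) as Fc; pose proof (bary_snd x y z c Hx) as Sc.
  pose proof (bary_sum x y z a Hx) as Ea; pose proof (bary_sum x y z b Hx) as Eb.
  pose proof (bary_sum x y z c Hx) as Ec.
  rewrite Za in *; rewrite Zb in *; rewrite Zc in *.
  unfold det3; rewrite Fa, Sa, Fb, Sb, Fc, Sc.
  replace (bary y z x a) with (1 - bary z x y a) by lra.
  replace (bary y z x b) with (1 - bary z x y b) by lra.
  replace (bary y z x c) with (1 - bary z x y c) by lra.
  ring.
Qed.

(** * Coordinates with respect to three null vectors *)

(** Minus the Minkowski product of the lifts [(1, a)] and [(1, b)]. On the unit circle it equals
    [|a - b|^2 / 2]. *)
Definition kgap (a b : hpoint) : R := 1 - kdot a b.

Lemma kgap_sym (a b : hpoint) : kgap a b = kgap b a.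
Proof. unfold kgap, kdot; ring. Qed.

Lemma kgap_pos (a b c : hpoint) : ideal_triangle a b c -> 0 < kgap a b.
Proof.
  intros (Ha & Hb & _ & Hd).
  assert (E : 2 * kgap a b = (fst a - fst b)² + (snd a - snd b)²).
  { unfold kgap, knorm2, kdot, Rsqr in *; nra. }
  pose proof (Rle_0_sqr (fst a - fst b)); pose proof (Rle_0_sqr (snd a - snd b)).
  destruct (Req_dec (kgap a b) 0) as [Hz|Hz]; [|lra].
  exfalso; apply Hd.
  assert (H1 : fst a - fst b = 0) by (apply Rsqr_0_uniq; lra).
  assert (H2 : snd a - snd b = 0) by (apply Rsqr_0_uniq; lra).
  unfold det3; replace (fst b) with (fst a) by lra; replace (snd b) with (snd a) by lra; ring.
Qed.

(** Bilinear expansion of the Minkowski product. The diagonal terms drop out because the lifts of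
    ideal points are null. *)
Lemma klein_gap_bary (a b c p q : hpoint) : ideal_triangle a b c ->
  kgap p q =
    kgap a b * (bary a b c p * bary b c a q + bary b c a p * bary a b c q) +
    kgap b c * (bary b c a p * bary c a b q + bary c a b p * bary b c a q) +
    kgap c a * (bary c a b p * bary a b c q + bary a b c p * bary c a b q).
Proof.
  intros (Ha & Hb & Hc & Hd).
  pose proof (bary_sum a b c p Hd) as Sp; pose proof (bary_sum a b c q Hd) as Sq.
  pose proof (bary_fst a b c p Hd) as Fp; pose proof (bary_snd a b c p Hd) as Gp.
  pose proof (bary_fst a b c q Hd) as Fq; pose proof (bary_snd a b c q Hd) as Gq.
  unfold kgap at 1, kdot; rewrite Fp, Gp, Fq, Gq.
  set (p1 := bary a b c p) in *; set (p2 := bary b c a p) in *; set (p3 := bary c a b p) in *.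
  set (q1 := bary a b c q) in *; set (q2 := bary b c a q) in *; set (q3 := bary c a b q) in *.
  assert (Za : kgap a a = 0) by (unfold kgap; fold (knorm2 a); lra).
  assert (Zb : kgap b b = 0) by (unfold kgap; fold (knorm2 b); lra).
  assert (Zc : kgap c c = 0) by (unfold kgap; fold (knorm2 c); lra).
  apply Rminus_diag_uniq.
  transitivity (- (p1 * q1 * kgap a a + p2 * q2 * kgap b b + p3 * q3 * kgap c c) * -1).
  - clearbody p1 p2 p3 q1 q2 q3; clear - Sp Sq.
    replace p3 with (1 - p1 - p2) by lra; replace q3 with (1 - q1 - q2) by lra.
    unfold kgap, kdot; ring.
  - rewrite Za, Zb, Zc; ring.
Qed.

(** The positive solution of the three equations saying that the weights of two vertices multiply to
    their gap. *)
Definition ideal_weight (a b c : hpoint) : R := sqrt (kgap a b * kgap a c / kgap b c).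

(* The coordinates of the Minkowski lift of [p] in the basis of null vectors over [a], [b], [c],
   scaled so that any two of the null vectors have product -1. *)
Definition ideal_coord (a b c p : hpoint) : R :=
  ideal_weight a b c * bary a b c p / sqrt (1 - knorm2 p).

Lemma ideal_weight_pos (a b c : hpoint) : ideal_triangle a b c -> 0 < ideal_weight a b c.
Proof.
  intros H; pose proof (kgap_pos _ _ _ H).
  pose proof (kgap_pos _ _ _ (ideal_triangle_rot _ _ _ H)).
  pose proof (kgap_pos _ _ _ (ideal_triangle_rot _ _ _ (ideal_triangle_rot _ _ _ H))).
  apply sqrt_lt_R0, Rdiv_lt_0_compat; auto; rewrite (kgap_sym a c); nra.
Qed.

Lemma ideal_weight_mul (a b c : hpoint) : ideal_triangle a b c ->
  ideal_weight a b c * ideal_weight b c a = kgap a b.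
Proof.
  intros H; pose proof (kgap_pos _ _ _ H) as H1.
  pose proof (kgap_pos _ _ _ (ideal_triangle_rot _ _ _ H)) as H2.
  pose proof (kgap_pos _ _ _ (ideal_triangle_rot _ _ _ (ideal_triangle_rot _ _ _ H))) as H3.
  unfold ideal_weight; rewrite <- sqrt_mult_alt.
  - rewrite (kgap_sym a c), (kgap_sym b a).
    replace (kgap a b * kgap c a / kgap b c * (kgap b c * kgap a b / kgap c a))
      with (kgap a b * kgap a b) by (field; lra).
    apply sqrt_square; lra.
  - apply Rlt_le, Rdiv_lt_0_compat; auto; rewrite (kgap_sym a c); nra.
Qed.

Lemma ideal_coord_gap (a b c p q : hpoint) : ideal_triangle a b c ->
  in_klein_disk p -> in_klein_disk q ->
  (1 - kdot p q) / sqrt ((1 - knorm2 p) * (1 - knorm2 q)) =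
    ideal_coord a b c p * ideal_coord b c a q + ideal_coord b c a p * ideal_coord a b c q +
    (ideal_coord b c a p * ideal_coord c a b q + ideal_coord c a b p * ideal_coord b c a q) +
    (ideal_coord c a b p * ideal_coord a b c q + ideal_coord a b c p * ideal_coord c a b q).
Proof.
  intros H Hp Hq; unfold in_klein_disk in *.
  fold (kgap p q); rewrite (klein_gap_bary a b c p q H).
  rewrite <- (ideal_weight_mul a b c H).
  rewrite <- (ideal_weight_mul b c a (ideal_triangle_rot _ _ _ H)).
  rewrite <- (ideal_weight_mul c a b (ideal_triangle_rot _ _ _ (ideal_triangle_rot _ _ _ H))).
  rewrite sqrt_mult_alt by lra.
  assert (0 < sqrt (1 - knorm2 p)) by (apply sqrt_lt_R0; lra).
  assert (0 < sqrt (1 - knorm2 q)) by (apply sqrt_lt_R0; lra).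
  unfold ideal_coord; field; lra.
Qed.

(** The preceding formula at [q = p], where the hyperbolic cosine is 1. *)
Lemma ideal_coord_norm (a b c p : hpoint) : ideal_triangle a b c -> in_klein_disk p ->
  ideal_coord a b c p * ideal_coord b c a p + ideal_coord b c a p * ideal_coord c a b p +
  ideal_coord c a b p * ideal_coord a b c p = 1 / 2.
Proof.
  intros H Hp; pose proof (ideal_coord_gap a b c p p H Hp Hp) as E.
  fold (knorm2 p) in E; unfold in_klein_disk in Hp.
  rewrite sqrt_square in E by lra.
  replace ((1 - knorm2 p) / (1 - knorm2 p)) with 1 in E by (field; lra); lra.
Qed.

Lemma ideal_coord_nonneg (a b c p : hpoint) : ideal_triangle a b c -> in_klein_disk p ->
  0 <= bary a b c p -> 0 <= ideal_coord a b c p.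
Proof.
  intros H Hp Hb; unfold in_klein_disk in Hp; unfold ideal_coord.
  pose proof (ideal_weight_pos a b c H).
  assert (0 < sqrt (1 - knorm2 p)) by (apply sqrt_lt_R0; lra).
  apply Rmult_le_pos; [nra|apply Rlt_le, Rinv_0_lt_compat; auto].
Qed.

(** The hyperbolic sine of the distance to the side opposite [b] is [sqrt 2] times the coordinate at
    [b]. *)
Lemma ideal_side_near (a b c p : hpoint) : ideal_triangle a b c -> in_klein_disk p ->
  in_triangle a b c p ->
  exists q, in_klein_disk q /\ bary b c a q = 0 /\ hdist p q <= 3 * ideal_coord b c a p.
Proof.
  intros H Hp (T1 & T2 & T3).
  pose proof (ideal_triangle_rot _ _ _ H) as H'.
  pose proof (ideal_triangle_rot _ _ _ H') as H''.
  pose proof (ideal_coord_norm a b c p H Hp) as Hn.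
  pose proof (ideal_coord_nonneg a b c p H Hp T1) as N1.
  pose proof (ideal_coord_nonneg b c a p H' Hp T2) as N2.
  pose proof (ideal_coord_nonneg c a b p H'' Hp T3) as N3.
  pose proof (ideal_weight_pos a b c H) as W1.
  pose proof (ideal_weight_pos c a b H'') as W3.
  set (x1 := ideal_coord a b c p) in *.
  set (x2 := ideal_coord b c a p) in *.
  set (x3 := ideal_coord c a b p) in *.
  set (w1 := ideal_weight a b c) in *.
  set (w3 := ideal_weight c a b) in *.
  (* the foot of the perpendicular has coordinates proportional to (x1 + x2, 0, x3 + x2) *)
  set (y1 := x1 + x2); set (y3 := x3 + x2).
  assert (Hy : 2 * (y1 * y3) = 1 + 2 * (x2 * x2)) by (unfold y1, y3; nra).
  assert (Y1 : 0 < y1) by (assert (0 <= y1) by (unfold y1; lra); assert (0 <= y3) by (unfold y3; lra); nra).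
  assert (Y3 : 0 < y3) by (assert (0 <= y3) by (unfold y3; lra); nra).
  (* Dividing by the weights returns to barycentric coordinates; [S] normalizes their sum to 1. *)
  set (S := y1 / w1 + y3 / w3).
  assert (Q1 : 0 < y1 / w1) by (apply Rdiv_lt_0_compat; lra).
  assert (Q3 : 0 < y3 / w3) by (apply Rdiv_lt_0_compat; lra).
  assert (HS : 0 < S) by (unfold S; lra).
  set (m1 := y1 / w1 / S); set (m3 := y3 / w3 / S).
  assert (Hm : m1 + 0 + m3 = 1) by (unfold m1, m3; rewrite Rplus_0_r, <- Rdiv_plus_distr; fold S; field; lra).
  set (q := (m1 * fst a + 0 * fst b + m3 * fst c, m1 * snd a + 0 * snd b + m3 * snd c)).
  pose proof H as (_ & _ & _ & Hd).
  assert (Hq : forall f g h, bary f g h q = m1 * bary f g h a + 0 * bary f g h b + m3 * bary f g h c).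
  { intros f g h; apply bary_comb3; auto. }
  assert (B1 : bary a b c q = m1).
  { rewrite Hq; unfold bary, det3 in *; field; auto. }
  assert (B2 : bary b c a q = 0).
  { rewrite Hq; unfold bary; rewrite (det3_rot a b c).
    replace (det3 a c a) with 0 by (unfold det3; ring).
    replace (det3 c c a) with 0 by (unfold det3; ring). field; auto. }
  assert (B3 : bary c a b q = m3).
  { pose proof (bary_sum a b c q Hd); lra. }
  pose proof (klein_gap_bary a b c q q H) as Hg.
  rewrite B1, B2, B3 in Hg.
  rewrite <- (ideal_weight_mul c a b H'') in Hg; fold w1 w3 in Hg.
  assert (Hgq : kgap q q = 2 * (y1 * y3) / (S * S)).
  { rewrite Hg; unfold m1, m3; field; repeat split; lra. }
  assert (Hyy : 0 < 2 * (y1 * y3)) by nra.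
  assert (Dq : in_klein_disk q).
  { unfold in_klein_disk, knorm2.
    assert (0 < kgap q q) by (rewrite Hgq; apply Rdiv_lt_0_compat; nra).
    unfold kgap in *; lra. }
  exists q; split; [auto|split; auto].
  unfold hdist; rewrite (ideal_coord_gap a b c p q H Hp Dq).
  fold x1 x2 x3.
  set (T := sqrt (1 + 2 * (x2 * x2))).
  assert (HT : T * T = 1 + 2 * (x2 * x2)) by (apply sqrt_sqrt; nra).
  assert (HT1 : 1 <= T).
  { unfold T; rewrite <- sqrt_1 at 1; apply sqrt_le_1_alt; nra. }
  assert (HTs : sqrt (1 - knorm2 q) = T / S).
  { unfold knorm2; fold (kgap q q); rewrite Hgq, Hy.
    rewrite sqrt_div_alt by nra; rewrite sqrt_square by lra; reflexivity. }
  assert (C1 : ideal_coord a b c q = y1 / T).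
  { unfold ideal_coord; rewrite HTs, B1; fold w1; unfold m1; field; repeat split; lra. }
  assert (C2 : ideal_coord b c a q = 0).
  { unfold ideal_coord; rewrite HTs, B2; field; split; lra. }
  assert (C3 : ideal_coord c a b q = y3 / T).
  { unfold ideal_coord; rewrite HTs, B3; fold w3; unfold m3; field; repeat split; lra. }
  rewrite C1, C2, C3.
  (* The hyperbolic cosine is [T = sqrt (1 + 2 x2^2)]. Both [T - 1] and [sqrt (2 x2^2)] are at most
     [3/2 x2]. *)
  match goal with |- acosh ?e <= _ => replace e with (1 + (T - 1)) end.
  - eapply Rle_trans; [apply acosh_1_plus_le; lra|].
    replace (2 * (T - 1) + (T - 1) * (T - 1)) with (2 * (x2 * x2)) by lra.
    assert (sqrt (2 * (x2 * x2)) <= 3 / 2 * x2).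
    { rewrite <- (sqrt_square (3 / 2 * x2)) by lra; apply sqrt_le_1_alt; nra. }
    assert (T <= 1 + 3 / 2 * x2) by (apply Rnot_lt_le; intro; nra).
    lra.
  - apply Rmult_eq_reg_r with T; [|lra].
    replace ((1 + (T - 1)) * T) with (1 + 2 * (x2 * x2)) by lra.
    transitivity (x2 * y1 + x2 * y3 + x3 * y1 + x1 * y3); [|field; lra].
    unfold y1, y3; lra.
Qed.

(** This is the distance formula of the upper half-plane with the third ideal vertex at infinity:
    height [1 / s] and abscissa [sqrt 2 * u], for [s = x1 + x2] and [u = x2 / s]. Eliminating [x3]
    and [y3] by the norm relations leaves an identity of rational functions. *)
Lemma ideal_coord_dist (x1 x2 x3 y1 y2 y3 : R) : 0 < x1 + x2 -> 0 < y1 + y2 ->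
  x1 * x2 + x2 * x3 + x3 * x1 = 1 / 2 -> y1 * y2 + y2 * y3 + y3 * y1 = 1 / 2 ->
  x1 * y2 + x2 * y1 + (x2 * y3 + x3 * y2) + (x3 * y1 + x1 * y3) =
  1 + ((x1 + x2 - (y1 + y2))² / (2 * ((x1 + x2) * (y1 + y2))) +
       (x1 + x2) * (y1 + y2) * (x2 / (x1 + x2) - y2 / (y1 + y2))²).
Proof.
  intros Hx Hy Ex Ey.
  replace x3 with ((1 / 2 - x1 * x2) / (x1 + x2)).
  2: { apply Rmult_eq_reg_r with (x1 + x2); [|lra]; unfold Rdiv at 1.
       rewrite Rmult_assoc, Rinv_l by lra; lra. }
  replace y3 with ((1 / 2 - y1 * y2) / (y1 + y2)).
  2: { apply Rmult_eq_reg_r with (y1 + y2); [|lra]; unfold Rdiv at 1.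
       rewrite Rmult_assoc, Rinv_l by lra; lra. }
  unfold Rsqr; field; lra.
Qed.

(** * Packing points in a triangle *)

(** [separated_count] with [d = r / 4]. The distance to the side opposite [b] gives [r <= 3 X2],
    hence [s >= d]. *)
Lemma ideal_sector_count (a b c : hpoint) (pos : nat -> hpoint) (r : R) (l : list nat) :
  ideal_triangle a b c -> 0 < r -> NoDup l ->
  (forall v, In v l -> in_klein_disk (pos v) /\ in_triangle a b c (pos v) /\
     ideal_coord a b c (pos v) <= ideal_coord c a b (pos v) /\
     ideal_coord b c a (pos v) <= ideal_coord c a b (pos v)) ->
  (forall v q, In v l -> in_klein_disk q -> bary b c a q = 0 -> r <= hdist (pos v) q) ->
  (forall v v', In v l -> In v' l -> v <> v' -> r <= hdist (pos v) (pos v')) ->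
  INR (length l) <= 128 / (r * r).
Proof.
  intros H Hr Hn Hl Hq Hs.
  pose proof (ideal_triangle_rot _ _ _ H) as H'.
  pose proof (ideal_triangle_rot _ _ _ H') as H''.
  set (X1 := fun v => ideal_coord a b c (pos v)).
  set (X2 := fun v => ideal_coord b c a (pos v)).
  set (X3 := fun v => ideal_coord c a b (pos v)).
  assert (HX : forall v, In v l -> 0 <= X1 v /\ r / 4 <= X2 v /\ X1 v <= X3 v /\ X2 v <= X3 v /\
     X1 v * X2 v + X2 v * X3 v + X3 v * X1 v = 1 / 2).
  { intros v Hv; destruct (Hl v Hv) as (Dv & Tv & O1 & O2).
    pose proof Tv as (T1 & T2 & T3).
    split; [apply ideal_coord_nonneg; auto|].
    split; [|split; [auto|split; [auto|apply ideal_coord_norm; auto]]].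
    destruct (ideal_side_near a b c (pos v) H Dv Tv) as (q & Dq & Bq & Hdq).
    pose proof (Hq v q Hv Dq Bq); unfold X2; lra. }
  replace (128 / (r * r)) with (8 / (r / 4 * (r / 4))) by (field; lra).
  (* In this sector [X3 >= s / 2], and [s X3 <= 1 / 2] by the norm relation, so [s <= 1]. *)
  assert (Hs1 : forall v, In v l -> r / 4 <= X1 v + X2 v <= 1).
  { intros v Hv; destruct (HX v Hv) as (P1 & P2 & P3 & P4 & P5); split; [lra|].
    apply Rnot_lt_le; intros Hlt.
    assert (0 <= (X3 v - (X1 v + X2 v) / 2) * (X1 v + X2 v)) by (apply Rmult_le_pos; lra).
    assert (0 <= X1 v * X2 v) by (apply Rmult_le_pos; lra).
    nra. }
  apply (separated_count (fun v => X2 v / (X1 v + X2 v)) (fun v => X1 v + X2 v) (r / 4)); auto.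
  - lra.
  - intros v Hv; destruct (HX v Hv) as (P1 & P2 & _).
    assert (0 < / (X1 v + X2 v)) by (apply Rinv_0_lt_compat; lra).
    split; [apply Rmult_le_pos; lra|].
    apply Rmult_le_reg_r with (X1 v + X2 v); [lra|].
    unfold Rdiv; rewrite Rmult_assoc, Rinv_l; lra.
  (* If [e <= r^2 / 16], then [e <= r / 4] because [r / 4 <= 1], and [sqrt (2 e + e^2) <= r / 2].
     The distance would be at most [3/4 r]. *)
  - intros v v' Hv Hv' Hne; apply Rnot_le_lt; intros Hle.
    destruct (HX v Hv) as (P1 & P2 & P3 & P4 & P5).
    destruct (HX v' Hv') as (R1 & R2 & R3 & R4 & R5).
    pose proof (Hs1 v Hv) as [_ S1].
    pose proof (Hs v v' Hv Hv' Hne) as Hd.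
    unfold hdist in Hd; rewrite (ideal_coord_gap a b c _ _ H) in Hd; try apply Hl; auto.
    fold (X1 v) (X2 v) (X3 v) (X1 v') (X2 v') (X3 v') in Hd.
    rewrite ideal_coord_dist in Hd; try lra.
    set (e := _ / _ + _ * _) in Hle.
    fold e in Hd.
    assert (He : 0 <= e).
    { unfold e; apply Rplus_le_le_0_compat; apply Rmult_le_pos; try apply Rle_0_sqr; [|nra].
      apply Rlt_le, Rinv_0_lt_compat; nra. }
    pose proof (acosh_1_plus_le e He).
    assert (e <= 1) by nra.
    assert (sqrt (2 * e + e * e) <= r / 2).
    { rewrite <- (sqrt_square (r / 2)) by lra; apply sqrt_le_1_alt; nra. }
    nra.
Qed.

Lemma triangle_packing (a b c : hpoint) (pos : nat -> hpoint) (r : R) (l : list nat) :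
  in_klein_disk a -> in_klein_disk b -> in_klein_disk c -> det3 a b c <> 0 ->
  0 < r -> NoDup l ->
  (forall v, In v l -> in_klein_disk (pos v) /\ in_triangle a b c (pos v)) ->
  (forall v q, In v l -> on_triangle_boundary a b c q -> r <= hdist (pos v) q) ->
  (forall v v', In v l -> In v' l -> v <> v' -> r <= hdist (pos v) (pos v')) ->
  INR (length l) <= 384 / (r * r).
Proof.
  intros Ha Hb Hc Hd Hr Hn Hl Hq Hs.
  destruct (ideal_triangle_exists a b c Ha Hb Hc Hd) as (x & y & z & H & Ta & Tb & Tc).
  pose proof (ideal_triangle_rot _ _ _ H) as H'.
  pose proof (ideal_triangle_rot _ _ _ H') as H''.
  assert (Hx : det3 x y z <> 0) by apply H.
  assert (Hl' : forall v, In v l -> in_triangle x y z (pos v)).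
  { intros v Hv; apply (in_triangle_trans x y z a b c); auto; apply Hl; auto. }
  (* A segment from a vertex to a point not strictly inside [a b c] meets the boundary of [a b c],
     and the meeting point is no farther away. *)
  assert (Hside : forall v q, In v l -> in_klein_disk q ->
    (bary a b c q <= 0 \/ bary b c a q <= 0 \/ bary c a b q <= 0) -> r <= hdist (pos v) q).
  { intros v q Hv Dq Ho; destruct (Hl v Hv) as [Dv Tv].
    destruct (triangle_exit a b c (pos v) q Hd Tv Ho) as (t & Ht & Hbd).
    apply Rle_trans with (hdist (pos v) (seg_pt (pos v) q t)); auto.
    apply hdist_seg_le; auto. }
  set (X1 := fun v => ideal_coord x y z (pos v)).
  set (X2 := fun v => ideal_coord y z x (pos v)).
  set (X3 := fun v => ideal_coord z x y (pos v)).
  (* Three sectors according to the largest coordinate. Where [f3] fails, the larger of [X1] and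
     [X2] is the maximum. *)
  set (f3 := fun v => andb (Rleb (X1 v) (X3 v)) (Rleb (X2 v) (X3 v))).
  set (f1 := fun v => Rleb (X2 v) (X1 v)).
  rewrite <- (filter_length f3 l), plus_INR.
  rewrite <- (filter_length f1 (filter (fun v => negb (f3 v)) l)), plus_INR.
  replace (384 / (r * r)) with (128 / (r * r) + (128 / (r * r) + 128 / (r * r))) by (field; lra).
  apply Rplus_le_compat; [|apply Rplus_le_compat].
  - apply (ideal_sector_count x y z pos r); auto; [now apply NoDup_filter| | |].
    + intros v Hv; apply filter_In in Hv; destruct Hv as [Hv Hf].
      unfold f3 in Hf; apply andb_prop in Hf; rewrite !Rleb_true in Hf.
      destruct (Hl v Hv); repeat split; try tauto; apply Hl'; auto.
    + intros v q Hv Dq Bq; apply filter_In in Hv; apply Hside; try tauto.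
      apply (bary_zero_outside y z x a b c q); auto; [apply H'|apply in_triangle_rot..]; auto.
    + intros v v' Hv Hv'; apply filter_In in Hv, Hv'; apply Hs; tauto.
  - apply (ideal_sector_count y z x pos r); auto; [now apply NoDup_filter, NoDup_filter| | |].
    + intros v Hv; apply filter_In in Hv; destruct Hv as [Hv Hf1].
      apply filter_In in Hv; destruct Hv as [Hv Hf3].
      unfold f1 in Hf1; apply Rleb_true in Hf1.
      unfold f3, Rleb in Hf3.
      destruct (Rle_dec (X1 v) (X3 v)), (Rle_dec (X2 v) (X3 v)); simpl in Hf3; try discriminate;
      (destruct (Hl v Hv); repeat split; try tauto; try (apply Hl'; auto);
       unfold X1, X2, X3 in *; lra).
    + intros v q Hv Dq Bq; do 2 apply filter_In, proj1 in Hv; apply Hside; try tauto.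
      apply (bary_zero_outside z x y a b c q); auto; [apply H''|apply in_triangle_rot, in_triangle_rot..]; auto.
    + intros v v' Hv Hv'; do 2 apply filter_In, proj1 in Hv; do 2 apply filter_In, proj1 in Hv'.
      apply Hs; tauto.
  - apply (ideal_sector_count z x y pos r); auto; [now apply NoDup_filter, NoDup_filter| | |].
    + intros v Hv; apply filter_In in Hv; destruct Hv as [Hv Hf1].
      apply filter_In in Hv; destruct Hv as [Hv Hf3].
      unfold f1 in Hf1; apply Rleb_false in Hf1.
      unfold f3, Rleb in Hf3.
      destruct (Rle_dec (X1 v) (X3 v)), (Rle_dec (X2 v) (X3 v)); simpl in Hf3; try discriminate;
      (destruct (Hl v Hv); repeat split; try tauto; try (apply Hl'; auto);
       unfold X1, X2, X3 in *; lra).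
    + intros v q Hv Dq Bq; do 2 apply filter_In, proj1 in Hv; apply Hside; try tauto.
      apply (bary_zero_outside x y z a b c q); auto.
    + intros v v' Hv Hv'; do 2 apply filter_In, proj1 in Hv; do 2 apply filter_In, proj1 in Hv'.
      apply Hs; tauto.
Qed.

(** * Exposed vertices of a straight-line drawing *)

(** A drawing freed from the disk: the redrawing in [no_isolated_pair] may place vertices outside
    it. *)
Definition straight_drawing (n : nat) (G : graph) (pos : nat -> hpoint) : Prop :=
  inj_on_vertices n pos /\
  (forall i j k l p, G i j -> G k l -> ~ same_edge i j k l ->
     on_seg p (pos i) (pos j) -> on_seg p (pos k) (pos l) ->
     exists v, (v = i \/ v = j) /\ (v = k \/ v = l) /\ p = pos v) /\
  (forall i j v, G i j -> (v < n)%nat -> v <> i -> v <> j ->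
     ~ on_seg (pos v) (pos i) (pos j)).

Lemma seg_pt_0 (a b : hpoint) : seg_pt a b 0 = a.
Proof. destruct a; unfold seg_pt; simpl; f_equal; ring. Qed.

Lemma seg_pt_1 (a b : hpoint) : seg_pt a b 1 = b.
Proof. destruct b; unfold seg_pt; simpl; f_equal; ring. Qed.

Lemma on_seg_l (a b : hpoint) : on_seg a a b.
Proof. exists 0; rewrite seg_pt_0; split; [lra|auto]. Qed.

Lemma on_seg_sym (p a b : hpoint) : on_seg p a b -> on_seg p b a.
Proof.
  intros (t & Ht & ->); exists (1 - t); split; [lra|].
  unfold seg_pt; f_equal; ring.
Qed.

Lemma seg_pt_inj (a b : hpoint) (s t : R) : a <> b -> seg_pt a b s = seg_pt a b t -> s = t.
Proof.
  destruct a as [a1 a2], b as [b1 b2]; unfold seg_pt; simpl; intros Hne H.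
  injection H; intros H2 H1.
  destruct (Req_dec s t) as [|Hst]; auto; exfalso; apply Hne; f_equal; nra.
Qed.

Lemma seg_pt_vertex_l (a b : hpoint) (s : R) : a <> b -> seg_pt a b s = a -> s = 0.
Proof. intros H E; apply (seg_pt_inj a b); auto; now rewrite seg_pt_0. Qed.

Lemma seg_pt_vertex_r (a b : hpoint) (s : R) : a <> b -> seg_pt a b s = b -> s = 1.
Proof. intros H E; apply (seg_pt_inj a b); auto; now rewrite seg_pt_1. Qed.

Lemma straight_edge_vertex (n : nat) (G : graph) (pos : nat -> hpoint) (i j v : nat) (s : R) :
  simple_graph n G -> straight_drawing n G pos -> G i j -> (v < n)%nat -> 0 <= s <= 1 ->
  seg_pt (pos i) (pos j) s = pos v -> (s = 0 /\ v = i) \/ (s = 1 /\ v = j).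
Proof.
  intros [Hs _] (Hinj & _ & Hv) Hij Hvn Hs01 E.
  destruct (Hs i j Hij) as (Hi & Hj & Hne).
  assert (Hp : pos i <> pos j) by (intros Hp; apply Hne; apply Hinj; auto).
  destruct (Nat.eq_dec v i) as [->|N1]; [left; split; auto; eapply seg_pt_vertex_l; eauto|].
  destruct (Nat.eq_dec v j) as [->|N2]; [right; split; auto; eapply seg_pt_vertex_r; eauto|].
  exfalso; apply (Hv i j v Hij Hvn N1 N2); exists s; split; auto.
Qed.

Lemma straight_edges_meet (n : nat) (G : graph) (pos : nat -> hpoint) (i j k l : nat) (s t : R) :
  simple_graph n G -> straight_drawing n G pos ->
  G i j -> (i < j)%nat -> G k l -> (k < l)%nat -> ~ (i = k /\ j = l) ->
  0 <= s <= 1 -> 0 <= t <= 1 -> seg_pt (pos i) (pos j) s = seg_pt (pos k) (pos l) t ->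
  (s = 0 \/ s = 1) /\ (t = 0 \/ t = 1).
Proof.
  intros Hsg Hd Hij Lij Hkl Lkl Hne Hs Ht E.
  pose proof Hd as (_ & Hc & _).
  destruct (Hc i j k l (seg_pt (pos i) (pos j) s) Hij Hkl) as (v & V1 & V2 & V3).
  - unfold same_edge; lia.
  - exists s; auto.
  - exists t; auto.
  - destruct Hsg as [Hs1 Hs2]; assert (Hvn : (v < n)%nat).
    { destruct (Hs1 i j Hij) as (? & ? & _); destruct V1; subst; auto. }
    split.
    + destruct (straight_edge_vertex n G pos i j v s); try tauto. split; auto.
    + rewrite E in V3; destruct (straight_edge_vertex n G pos k l v t); try tauto. split; auto.
Qed.

Lemma affine_continuity (a b : R) : continuity (fun t => (1 - t) * a + t * b).
Proof.
  intros t; apply continuity_pt_filterlim.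
  apply (ex_derive_continuous (fun t => (1 - t) * a + t * b)); auto_derive; auto.
Qed.

Lemma straight_drawing_planar (n : nat) (G : graph) (pos : nat -> hpoint) :
  simple_graph n G -> straight_drawing n G pos -> planar n G.
Proof.
  intros Hsg Hd; exists pos, (fun i j => seg_pt (pos i) (pos j)).
  pose proof Hd as (Hinj & _ & _); pose proof Hsg as [Hs _].
  split; [auto|split; [|split]].
  - intros i j Hij Lij; destruct (Hs i j Hij) as (Hi & Hj & Hne).
    split; [apply affine_continuity|split; [apply affine_continuity|]].
    rewrite seg_pt_0, seg_pt_1; split; [auto|split; [auto|]].
    intros s t _ _; apply seg_pt_inj; intros Hp; apply Hne, Hinj; auto.
  - intros i j v s Hij _ Hv Hs01 E.
    destruct (straight_edge_vertex n G pos i j v s Hsg Hd Hij Hv) as [[? _]|[? _]]; auto; lra.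
  - intros i j k l s t; apply (straight_edges_meet n G); auto.
Qed.

(** The strict inequality leaves out vertices in the relative interior of a hull side, and it
    survives small changes of [f]. *)
Definition exposed (n : nat) (pos : nat -> hpoint) (f : hpoint) (u : nat) : Prop :=
  forall x, (x < n)%nat -> x <> u -> kdot f (pos x) < kdot f (pos u).

Lemma exposed_le (n : nat) (pos : nat -> hpoint) (f : hpoint) (u x : nat) :
  exposed n pos f u -> (x < n)%nat -> kdot f (pos x) <= kdot f (pos u).
Proof.
  intros H Hx; destruct (Nat.eq_dec x u) as [->|Hne]; [lra|apply Rlt_le, H; auto].
Qed.

Lemma kdot_seg (f a b : hpoint) (t : R) :
  kdot f (seg_pt a b t) = (1 - t) * kdot f a + t * kdot f b.
Proof. unfold kdot, seg_pt; simpl; ring. Qed.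

Lemma exposed_seg (n : nat) (pos : nat -> hpoint) (f p : hpoint) (u k l : nat) :
  exposed n pos f u -> (k < n)%nat -> (l < n)%nat -> on_seg p (pos k) (pos l) ->
  kdot f p <= kdot f (pos u).
Proof.
  intros H Hk Hl (t & Ht & ->); rewrite kdot_seg.
  pose proof (exposed_le _ _ _ _ _ H Hk); pose proof (exposed_le _ _ _ _ _ H Hl); nra.
Qed.

(** A tie-breaker with a small coefficient turns a strict lexicographic maximum into a strict
    maximum; each [x] with [F x < F u] bounds the coefficient. *)
Lemma lex_perturb (F G : nat -> R) (u n : nat) :
  (forall x, (x < n)%nat -> x <> u -> F x <= F u /\ (F x = F u -> G x < G u)) ->
  exists e0, 0 < e0 /\ forall e, 0 < e < e0 -> forall x, (x < n)%nat -> x <> u ->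
    F x + e * G x < F u + e * G u.
Proof.
  induction n as [|n IH]; intros H.
  - exists 1; split; [lra|intros; lia].
  - destruct IH as (e0 & He0 & IH); [intros; apply H; auto; lia|].
    destruct (Nat.eq_dec n u) as [->|Hne].
    { exists e0; split; auto; intros e He x Hx Hxu; apply IH; auto; lia. }
    destruct (H n (Nat.lt_succ_diag_r n) Hne) as [H1 H2].
    destruct (Rle_lt_or_eq_dec _ _ H1) as [Hlt|Heq].
    + set (D := 1 + Rabs (G n - G u)).
      pose proof (Rabs_pos (G n - G u)); pose proof (Rle_abs (G n - G u)).
      assert (HD : 1 <= D) by (unfold D; lra).
      assert (He1 : 0 < (F u - F n) / D) by (apply Rdiv_lt_0_compat; lra).
      exists (Rmin e0 ((F u - F n) / D)); split; [apply Rmin_pos; auto|].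
      intros e [E1 E2] x Hx Hxu.
      pose proof (Rmin_l e0 ((F u - F n) / D)); pose proof (Rmin_r e0 ((F u - F n) / D)).
      destruct (Nat.eq_dec x n) as [->|Hxn]; [|apply IH; auto; [lra|lia]].
      assert (e * D < F u - F n).
      { apply Rlt_le_trans with ((F u - F n) / D * D); [apply Rmult_lt_compat_r; lra|].
        right; field; lra. }
      assert (e * (G n - G u) <= e * D) by (apply Rmult_le_compat_l; unfold D; lra).
      lra.
    + exists e0; split; auto; intros e He x Hx Hxu.
      destruct (Nat.eq_dec x n) as [->|Hxn]; [|apply IH; auto; lia].
      specialize (H2 Heq); nra.
Qed.

Lemma kdot_perturb (f g p : hpoint) (e : R) :
  kdot (fst f + e * fst g, snd f + e * snd g) p = kdot f p + e * kdot g p.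
Proof. unfold kdot; simpl; ring. Qed.

Lemma lex_exposed (n : nat) (pos : nat -> hpoint) (f g : hpoint) (u : nat) :
  (forall x, (x < n)%nat -> x <> u -> kdot f (pos x) <= kdot f (pos u) /\
     (kdot f (pos x) = kdot f (pos u) -> kdot g (pos x) < kdot g (pos u))) ->
  exists h, exposed n pos h u.
Proof.
  intros H.
  destruct (lex_perturb (fun x => kdot f (pos x)) (fun x => kdot g (pos x)) u n H)
    as (e0 & He0 & He).
  exists (fst f + e0 / 2 * fst g, snd f + e0 / 2 * snd g).
  intros x Hx Hxu; rewrite !kdot_perturb; apply He; auto; lra.
Qed.

(* The half-planes beyond two exposed vertices can miss each other only if they are antiparallel,
   which a small perturbation destroys. *)
Lemma exposed_common_direction (n : nat) (pos : nat -> hpoint) (f g : hpoint) (i j : nat) :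
  (i < n)%nat -> (j < n)%nat -> i <> j -> exposed n pos f i -> exposed n pos g j ->
  exists f' e, exposed n pos f' i /\ kdot f' e = 1 /\ kdot g e = 1.
Proof.
  intros Hi Hj Hne Hf Hg.
  assert (Hsolve : forall f' : hpoint, fst f' * snd g - snd f' * fst g <> 0 ->
    exists e, kdot f' e = 1 /\ kdot g e = 1).
  { intros f' HD; set (D := fst f' * snd g - snd f' * fst g) in *.
    exists ((snd g - snd f') / D, (fst f' - fst g) / D).
    unfold kdot; simpl; split; unfold D; field; auto. }
  destruct (Req_dec (fst f * snd g - snd f * fst g) 0) as [HD|HD].
  - destruct (lex_perturb (fun x => kdot f (pos x)) (fun x => kdot (- snd f, fst f) (pos x)) i n)
      as (e0 & He0 & He).
    { intros x Hx Hxi; pose proof (Hf x Hx Hxi); lra. }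
    set (f' := (fst f + e0 / 2 * - snd f, snd f + e0 / 2 * fst f)).
    destruct (Hsolve f') as (e & E1 & E2).
    (* The determinant of [f'] and [g] is [- e0 / 2 * kdot f g]. Both [f] and [g] are nonzero,
       because they separate [i] from [j]; being parallel, they are not orthogonal. *)
    + assert (Hfg : kdot f g <> 0).
      { intros Hfg.
        pose proof (Hf j Hj (not_eq_sym Hne)) as F1; pose proof (Hg i Hi Hne) as G1.
        assert (HH : knorm2 f * knorm2 g = 0).
        { unfold knorm2, kdot in *.
          transitivity ((fst f * snd g - snd f * fst g) * (fst f * snd g - snd f * fst g) +
            (fst f * fst g + snd f * snd g) * (fst f * fst g + snd f * snd g)); [ring|].
          rewrite HD, Hfg; ring. }
        assert (Hz : forall h : hpoint, knorm2 h = 0 -> forall p, kdot h p = 0).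
        { intros [h1 h2] Hh p; unfold knorm2, kdot in *; simpl in *.
          assert (h1 = 0) by nra; assert (h2 = 0) by nra; subst; ring. }
        destruct (Rmult_integral _ _ HH) as [Z|Z]; rewrite !(Hz _ Z) in *; lra. }
      intros H0; apply Hfg; unfold f', kdot in *; simpl in *; nra.
    + exists f', e; split; [|auto].
      intros x Hx Hxi; unfold f'.
      pose proof (He (e0 / 2) ltac:(lra) x Hx Hxi) as P; simpl in P.
      rewrite <- !kdot_perturb in P; exact P.
  - destruct (Hsolve f HD) as (e & E1 & E2); exists f, e; auto.
Qed.

(* A parabolic arc leaving [p] and reaching [q] in the direction [e]; for [M] large it stays
   outside the convex hull. *)
Definition arc (p q e : hpoint) (M t : R) : hpoint :=
  (fst p + t * (fst q - fst p) + t * (1 - t) * M * fst e,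
   snd p + t * (snd q - snd p) + t * (1 - t) * M * snd e).

Lemma arc_continuity (p d M e : R) : continuity (fun t => p + t * d + t * (1 - t) * M * e).
Proof.
  intros t; apply continuity_pt_filterlim.
  apply (ex_derive_continuous (fun t => p + t * d + t * (1 - t) * M * e)); auto_derive; auto.
Qed.

Lemma kdot_arc (f p q e : hpoint) (M t : R) :
  kdot f (arc p q e M t) = kdot f p + t * (kdot f q - kdot f p) + t * (1 - t) * M * kdot f e.
Proof. unfold kdot, arc; simpl; ring. Qed.

Lemma outer_edge_planar (n : nat) (G : graph) (pos : nat -> hpoint) (f g : hpoint) (i j : nat) :
  simple_graph n G -> straight_drawing n G pos -> (i < j)%nat -> (j < n)%nat ->
  exposed n pos f i -> exposed n pos g j -> planar n (add_edge G i j).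
Proof.
  intros Hsg Hd Hij Hj Hf0 Hg.
  assert (Hi : (i < n)%nat) by lia.
  destruct (exposed_common_direction n pos f g i j Hi Hj ltac:(lia) Hf0 Hg)
    as (f' & e & Hf & Ef & Eg).
  clear f Hf0; rename f' into f.
  pose proof (Hf j Hj ltac:(lia)) as Df; pose proof (Hg i Hi ltac:(lia)) as Dg.
  (* An interior point of the arc on a segment between vertices would satisfy
     [(1 - t) M <= f(i) - f(j)] and [t M <= g(j) - g(i)]. Adding these gives [M <= M / 2], while
     [M > 0]. *)
  set (M := 2 * (kdot f (pos i) - kdot f (pos j)) + 2 * (kdot g (pos j) - kdot g (pos i))).
  set (w := arc (pos i) (pos j) e M).
  assert (W0 : w 0 = pos i) by (unfold w, arc; destruct (pos i); simpl; f_equal; ring).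
  assert (W1 : w 1 = pos j) by (unfold w, arc; destruct (pos j); simpl; f_equal; ring).
  assert (Wout : forall t k l, 0 < t < 1 -> (k < n)%nat -> (l < n)%nat ->
    ~ on_seg (w t) (pos k) (pos l)).
  { intros t k l Ht Hk Hl Hon.
    pose proof (exposed_seg n pos f (w t) i k l Hf Hk Hl Hon) as P1.
    pose proof (exposed_seg n pos g (w t) j k l Hg Hk Hl Hon) as P2.
    unfold w in P1, P2; rewrite kdot_arc, Ef in P1; rewrite kdot_arc, Eg in P2.
    assert (HM : M = 2 * (kdot f (pos i) - kdot f (pos j)) + 2 * (kdot g (pos j) - kdot g (pos i)))
      by reflexivity.
    clearbody M; clear - P1 P2 HM Ht Df Dg.
    set (fi := kdot f (pos i)) in *; set (fj := kdot f (pos j)) in *.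
    set (gi := kdot g (pos i)) in *; set (gj := kdot g (pos j)) in *.
    assert (Q1 : t * ((1 - t) * M - (fi - fj)) <= 0) by lra.
    assert (Q2 : (1 - t) * (t * M - (gj - gi)) <= 0) by lra.
    assert (R1 : (1 - t) * M - (fi - fj) <= 0) by nra.
    assert (R2 : t * M - (gj - gi) <= 0) by nra.
    lra. }
  assert (Wvert : forall t v, 0 < t < 1 -> (v < n)%nat -> w t <> pos v).
  { intros t v Ht Hv E; apply (Wout t v v Ht Hv Hv); rewrite E; apply on_seg_l. }
  assert (Winj : forall s t, w s = w t -> s = t).
  { intros s t E.
    (* A functional vanishing on [e] does not see the parabolic term, so it is affine along the arc.
       It is not constant there: [f] decreases and [g] increases from [pos i] to [pos j], while both
       increase along [e]. *)
    set (q := fun p : hpoint => fst e * snd p - snd e * fst p).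
    assert (Hq : forall t, q (w t) = q (pos i) + t * (q (pos j) - q (pos i))).
    { intros x; unfold q, w, arc; simpl; ring. }
    assert (Hqq : q (pos j) - q (pos i) <> 0).
    { intros H0; unfold q in H0.
      unfold kdot in Ef, Eg, Df, Dg.
      set (d1 := fst (pos j) - fst (pos i)).
      set (d2 := snd (pos j) - snd (pos i)).
      assert (Z : fst e * d2 - snd e * d1 = 0) by (unfold d1, d2; lra).
      assert (F : fst f * d1 + snd f * d2 < 0) by (unfold d1, d2; lra).
      assert (K : 0 < fst g * d1 + snd g * d2) by (unfold d1, d2; lra).
      clearbody d1 d2; clear - Ef Eg Z F K.
      (* [e] and [d] are parallel, so [d = (f.d) e = (g.d) e] *)
      assert (X1 : d1 = (fst f * d1 + snd f * d2) * fst e).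
      { transitivity (d1 * (fst f * fst e + snd f * snd e) + snd f * (fst e * d2 - snd e * d1));
        [rewrite Ef, Z|]; ring. }
      assert (X2 : d2 = (fst f * d1 + snd f * d2) * snd e).
      { transitivity (d2 * (fst f * fst e + snd f * snd e) - fst f * (fst e * d2 - snd e * d1));
        [rewrite Ef, Z|]; ring. }
      assert (X : fst g * d1 + snd g * d2 =
        (fst f * d1 + snd f * d2) * (fst g * fst e + snd g * snd e)).
      { rewrite X1 at 1; rewrite X2 at 2; ring. }
      rewrite Eg in X; lra. }
    pose proof (Hq s) as E1; rewrite E, Hq in E1.
    apply Rmult_eq_reg_r with (q (pos j) - q (pos i)); auto; lra. }
  pose proof Hsg as [Hs Hsym]; pose proof Hd as (Hinj & _ & _).
  assert (Wcont : continuity (fun t => fst (w t)) /\ continuity (fun t => snd (w t))).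
  { split; apply arc_continuity. }
  set (c := fun a b => if andb (Nat.eqb a i) (Nat.eqb b j) then w else seg_pt (pos a) (pos b)).
  assert (Hc : forall a b, add_edge G i j a b -> (a < b)%nat ->
    (a = i /\ b = j /\ c a b = w) \/ (~ (a = i /\ b = j) /\ G a b /\ c a b = seg_pt (pos a) (pos b))).
  { intros a b Hab Lab; unfold c.
    destruct (Nat.eqb_spec a i) as [->|N1]; [destruct (Nat.eqb_spec b j) as [->|N2]|]; simpl; auto;
    right; (split; [tauto|split; [|auto]]);
    (destruct Hab as [Hab|Hab]; [auto|unfold same_edge in Hab; exfalso; lia]). }
  assert (Hmix : forall k l s t, G k l -> 0 <= s <= 1 -> 0 <= t <= 1 ->
    w s = seg_pt (pos k) (pos l) t -> (s = 0 \/ s = 1) /\ (t = 0 \/ t = 1)).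
  { intros k l s t Hkl Hs01 Ht E; destruct (Hs k l Hkl) as (Hk & Hl & _).
    assert (S : s = 0 \/ s = 1).
    { destruct (Req_dec s 0); auto; destruct (Req_dec s 1); auto; exfalso.
      apply (Wout s k l); auto; [lra|]; exists t; auto. }
    split; auto; destruct S as [->| ->]; [rewrite W0 in E|rewrite W1 in E]; symmetry in E.
    - destruct (straight_edge_vertex n G pos k l i t); try tauto.
    - destruct (straight_edge_vertex n G pos k l j t); try tauto. }
  exists pos, c; split; [auto|split; [|split]].
  - intros a b Hab Lab.
    destruct (Hc a b Hab Lab) as [(-> & -> & ->)|(_ & Gab & ->)].
    + split; [apply Wcont|split; [apply Wcont|split; [auto|split; [auto|]]]].
      intros s t _ _; apply Winj.
    + destruct (Hs a b Gab) as (Ha & Hb & Hne).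
      split; [apply affine_continuity|split; [apply affine_continuity|]].
      rewrite seg_pt_0, seg_pt_1; split; [auto|split; [auto|]].
      intros s t _ _; apply seg_pt_inj; intros Hp; apply Hne, Hinj; auto.
  - intros a b v s Hab Lab Hv Hs01.
    destruct (Hc a b Hab Lab) as [(-> & -> & ->)|(_ & Gab & ->)]; [apply Wvert; auto|].
    intros E; destruct (straight_edge_vertex n G pos a b v s Hsg Hd Gab Hv) as [[? _]|[? _]]; auto; lra.
  - intros a b k l s t Hab Lab Hkl Lkl Hne Hs01 Ht.
    destruct (Hc a b Hab Lab) as [(-> & -> & ->)|(_ & Gab & ->)];
    destruct (Hc k l Hkl Lkl) as [(-> & -> & ->)|(_ & Gkl & ->)].
    + tauto.
    + apply Hmix; auto.
    + intros E; apply and_comm; apply (Hmix a b); auto.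
    + apply (straight_edges_meet n G); auto.
Qed.

Lemma exposed_adjacent (n : nat) (G : graph) (pos : nat -> hpoint) (f g : hpoint) (i j : nat) :
  maximal_planar n G -> straight_drawing n G pos -> (i < n)%nat -> (j < n)%nat -> i <> j ->
  exposed n pos f i -> exposed n pos g j -> G i j.
Proof.
  intros (Hsg & _ & Hmax) Hd Hi Hj Hne Hf Hg.
  pose proof Hsg as [_ Hsym].
  destruct (Nat.lt_total i j) as [L|[L|L]]; [|lia|].
  - apply NNPP; intros N; apply (Hmax i j Hi Hj Hne N).
    apply (outer_edge_planar n G pos f g); auto.
  - apply Hsym, NNPP; intros N; apply (Hmax j i Hj Hi (not_eq_sym Hne) N).
    apply (outer_edge_planar n G pos g f); auto.
Qed.

Lemma knorm2_pos_exposed (n : nat) (pos : nat -> hpoint) (f : hpoint) (a x : nat) :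
  exposed n pos f a -> (x < n)%nat -> x <> a -> 0 < knorm2 f.
Proof.
  intros Hf Hx Hxa; pose proof (Hf x Hx Hxa) as H; unfold knorm2, kdot in *.
  destruct (Req_dec (fst f) 0) as [Z1|]; [destruct (Req_dec (snd f) 0) as [Z2|]|]; [|nra|nra].
  rewrite Z1, Z2 in H; lra.
Qed.

(* Otherwise [u] and [v] could be moved outside the hull, to [a + f] and [a + 2 f], and [u] joined
   to [a]. *)
Lemma no_isolated_pair (n : nat) (G : graph) (pos : nat -> hpoint) (f : hpoint) (a u v : nat) :
  maximal_planar n G -> straight_drawing n G pos -> exposed n pos f a ->
  (a < n)%nat -> (u < n)%nat -> (v < n)%nat -> u <> v -> u <> a -> v <> a ->
  (forall x, G u x -> x = v) -> (forall x, G v x -> x = u) -> False.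
Proof.
  intros (Hsg & _ & Hmax) Hd Hf Ha Hu Hv Huv Hua Hva Gu Gv.
  pose proof Hsg as [Hs Hsym]; pose proof Hd as (Hinj & Hc & Hvx).
  apply (Hmax u a Hu Ha Hua); [intros H; apply Gu in H; auto|].
  set (ray := fun t => (fst (pos a) + t * fst f, snd (pos a) + t * snd f)).
  pose proof (knorm2_pos_exposed n pos f a u Hf Hu Hua) as Hff.
  assert (Kray : forall t, kdot f (ray t) = kdot f (pos a) + t * knorm2 f).
  { intros t; unfold ray, knorm2, kdot; simpl; ring. }
  assert (Rinj : forall s t, ray s = ray t -> s = t).
  { intros s t E; apply Rmult_eq_reg_r with (knorm2 f); [|lra].
    pose proof (Kray s) as P; rewrite E, Kray in P; lra. }
  assert (R0 : ray 0 = pos a) by (unfold ray; destruct (pos a); simpl; f_equal; ring).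
  assert (Rpos : forall t x, (x < n)%nat -> ray t = pos x -> t <= 0).
  { intros t x Hx E; pose proof (exposed_le n pos f a x Hf Hx) as P.
    rewrite <- E, Kray in P; nra. }
  set (pos' := fun x => if Nat.eqb x u then ray 1 else if Nat.eqb x v then ray 2 else pos x).
  assert (Pu : pos' u = ray 1) by (unfold pos'; now rewrite Nat.eqb_refl).
  assert (Pv : pos' v = ray 2).
  { unfold pos'; rewrite (proj2 (Nat.eqb_neq v u)), Nat.eqb_refl; auto. }
  assert (Po : forall x, x <> u -> x <> v -> pos' x = pos x).
  { intros x X1 X2; unfold pos'.
    rewrite (proj2 (Nat.eqb_neq x u)), (proj2 (Nat.eqb_neq x v)); auto. }
  assert (Hcl : forall x, (x = u /\ pos' x = ray 1) \/ (x = v /\ pos' x = ray 2) \/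
                          (x <> u /\ x <> v /\ pos' x = pos x)).
  { intros x; destruct (Nat.eq_dec x u) as [->|]; auto.
    destruct (Nat.eq_dec x v) as [->|]; auto 6. }
  assert (Ray_seg : forall s t p, s <= t -> on_seg p (ray s) (ray t) ->
     exists w, s <= w <= t /\ p = ray w).
  { intros s t p Hst (x & Hx & ->); exists ((1 - x) * s + x * t); split; [nra|].
    unfold seg_pt, ray; simpl; f_equal; ring. }
  set (G' := add_edge G u a).
  assert (Hsg' : simple_graph n G').
  { split; intros i j [H|H].
    - apply Hs; auto.
    - unfold same_edge in H; lia.
    - left; auto.
    - right; unfold same_edge in *; tauto. }
  (* Every edge of the new drawing is an old segment avoiding [u] and [v], or one of the pieces
     [[0, 1]] and [[1, 2]] of the ray. *)
  assert (HG' : forall i j p, G' i j -> on_seg p (pos' i) (pos' j) ->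
     (i <> u /\ i <> v /\ j <> u /\ j <> v /\ G i j /\ on_seg p (pos i) (pos j)) \/
     (same_edge i j u a /\ exists t, 0 <= t <= 1 /\ p = ray t) \/
     (same_edge i j u v /\ exists t, 1 <= t <= 2 /\ p = ray t)).
  { intros i j p [Gij|Gij] Hon.
    - destruct (Nat.eq_dec i u) as [->|I1].
      { rewrite (Gu j Gij) in *; rewrite Pu, Pv in Hon; right; right; split; [left; auto|].
        apply (Ray_seg 1 2); [lra|auto]. }
      destruct (Nat.eq_dec i v) as [->|I2].
      { rewrite (Gv j Gij) in *; rewrite Pu, Pv in Hon; right; right; split; [right; auto|].
        apply (Ray_seg 1 2); [lra|apply on_seg_sym; auto]. }
      destruct (Nat.eq_dec j u) as [->|J1]; [exfalso; apply I2, Gu, Hsym; auto|].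
      destruct (Nat.eq_dec j v) as [->|J2]; [exfalso; apply I1, Gv, Hsym; auto|].
      left; rewrite !Po in Hon by auto; repeat split; auto.
    - right; left; split; auto.
      destruct Gij as [[-> ->]|[-> ->]]; rewrite Pu, (Po a), <- R0 in Hon by auto.
      + apply (Ray_seg 0 1); [lra|apply on_seg_sym; auto].
      + apply (Ray_seg 0 1); [lra|auto]. }
  assert (Hin : forall i j, G i j -> (i < n)%nat /\ (j < n)%nat).
  { intros i j H; destruct (Hs i j H) as (? & ? & _); auto. }
  (* For [t > 0] the value of [f] at [ray t] exceeds its maximum over the hull. *)
  assert (Hold : forall i j t, G i j -> on_seg (ray t) (pos i) (pos j) -> t <= 0).
  { intros i j t Gij Hon; destruct (Hin i j Gij) as [Hi Hj].
    pose proof (exposed_seg n pos f _ a i j Hf Hi Hj Hon) as P; rewrite Kray in P; nra. }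
  assert (Holda : forall i j t, G i j -> 0 <= t -> on_seg (ray t) (pos i) (pos j) ->
    (a = i \/ a = j) /\ ray t = pos a).
  { intros i j t Gij Ht Hon; pose proof (Hold i j t Gij Hon).
    replace t with 0 in * by lra; rewrite R0 in *; split; auto.
    destruct (Nat.eq_dec a i); auto; destruct (Nat.eq_dec a j); auto.
    exfalso; apply (Hvx i j a); auto. }
  apply (straight_drawing_planar n G' pos' Hsg'); split; [|split].
  - intros x y Hx Hy E.
    destruct (Hcl x) as [[-> Ex]|[[-> Ex]|(X1 & X2 & Ex)]];
    destruct (Hcl y) as [[-> Ey]|[[-> Ey]|(Y1 & Y2 & Ey)]]; auto; rewrite Ex, Ey in E.
    + apply Rinj in E; lra.
    + apply Rpos in E; auto; lra.
    + apply Rinj in E; lra.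
    + apply Rpos in E; auto; lra.
    + symmetry in E; apply Rpos in E; auto; lra.
    + symmetry in E; apply Rpos in E; auto; lra.
    + apply Hinj; auto.
  - intros i j k l p Gij Gkl Hne H1 H2.
    destruct (HG' i j p Gij H1) as [(I1 & I2 & J1 & J2 & Eij & O1)|[(S1 & t & Ht & Et)|(S1 & t & Ht & Et)]];
    destruct (HG' k l p Gkl H2) as [(K1 & K2 & L1 & L2 & Ekl & O2)|[(S2 & s & Hs' & Es)|(S2 & s & Hs' & Es)]].
    + destruct (Hc i j k l p Eij Ekl Hne O1 O2) as (x & X1 & X2 & X3).
      exists x; split; auto; split; auto; rewrite X3; symmetry; apply Po; lia.
    + subst p; destruct (Holda i j s Eij ltac:(lra) O1) as [A1 A2].
      exists a; split; auto; split; [unfold same_edge in S2; lia|rewrite A2, Po; auto].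
    + subst p; pose proof (Hold i j s Eij O1); lra.
    + subst p; destruct (Holda k l t Ekl ltac:(lra) O2) as [A1 A2].
      exists a; split; [unfold same_edge in S1; lia|split; auto; rewrite A2, Po; auto].
    + exfalso; apply Hne; unfold same_edge in *; lia.
    + rewrite Et in Es; apply Rinj in Es.
      exists u; split; [unfold same_edge in S1; lia|split; [unfold same_edge in S2; lia|]].
      rewrite Pu, Et; f_equal; lra.
    + subst p; pose proof (Hold k l t Ekl O2); lra.
    + rewrite Et in Es; apply Rinj in Es.
      exists u; split; [unfold same_edge in S1; lia|split; [unfold same_edge in S2; lia|]].
      rewrite Pu, Et; f_equal; lra.
    + exfalso; apply Hne; unfold same_edge in *; lia.
  - intros i j x Gij Hx Xi Xj Hon.
    destruct (HG' i j (pos' x) Gij Hon) as [(I1 & I2 & J1 & J2 & Eij & O1)|[(S1 & t & Ht & Et)|(S1 & t & Ht & Et)]];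
    destruct (Hcl x) as [[-> Ex]|[[-> Ex]|(X1 & X2 & Ex)]]; rewrite Ex in *.
    + pose proof (Hold i j 1 Eij O1); lra.
    + pose proof (Hold i j 2 Eij O1); lra.
    + apply (Hvx i j x); auto.
    + unfold same_edge in S1; lia.
    + apply Rinj in Et; lra.
    + symmetry in Et; pose proof (Rpos t x Hx Et).
      replace t with 0 in Et by lra; rewrite R0 in Et.
      apply Hinj in Et; auto; unfold same_edge in S1; lia.
    + unfold same_edge in S1; lia.
    + unfold same_edge in S1; lia.
    + symmetry in Et; pose proof (Rpos t x Hx Et); lra.
Qed.

(** * The outer triangle *)

Lemma lex_max (P : nat -> Prop) (F G : nat -> R) (n : nat) :
  (exists x, (x < n)%nat /\ P x) ->
  exists u, (u < n)%nat /\ P u /\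
    forall x, (x < n)%nat -> P x -> F x <= F u /\ (F x = F u -> G x <= G u).
Proof.
  induction n as [|n IH]; intros (x & Hx & Px); [lia|].
  destruct (classic (exists y, (y < n)%nat /\ P y)) as [E|E].
  - destruct (IH E) as (u & Hu & Pu & Hmax).
    destruct (classic (P n /\ (F u < F n \/ (F u = F n /\ G u < G n)))) as [[Pn Hn]|Hn].
    + exists n; split; [lia|split; [auto|]].
      intros y Hy Py; destruct (Nat.eq_dec y n) as [->|]; [lra|].
      destruct (Hmax y ltac:(lia) Py) as [M1 M2].
      split; [lra|intros Ey].
      destruct Hn as [Hn|[Hn1 Hn2]]; [lra|]; assert (G y <= G u) by (apply M2; lra); lra.
    + exists u; split; [lia|split; [auto|]].
      intros y Hy Py; destruct (Nat.eq_dec y n) as [->|]; [|apply Hmax; auto; lia].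
      split; [apply Rnot_lt_le|intros Ey; apply Rnot_lt_le]; intros H; apply Hn; auto.
  - assert (x = n) by (apply NNPP; intros N; apply E; exists x; split; auto; lia); subst x.
    exists n; split; [lia|split; auto].
    intros y Hy Py; destruct (Nat.eq_dec y n) as [->|]; [lra|].
    exfalso; apply E; exists y; split; auto; lia.
Qed.

Lemma kdot_perp_eq (f p q : hpoint) : 0 < knorm2 f -> kdot f p = kdot f q ->
  kdot (- snd f, fst f) p = kdot (- snd f, fst f) q -> p = q.
Proof.
  destruct f as [f1 f2], p as [p1 p2], q as [q1 q2]; unfold knorm2, kdot; simpl; intros H E1 E2.
  f_equal.
  - apply Rmult_eq_reg_l with (f1 * f1 + f2 * f2); [|lra].
    transitivity (f1 * (f1 * p1 + f2 * p2) - f2 * (- f2 * p1 + f1 * p2)); [ring|].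
    rewrite E1, E2; ring.
  - apply Rmult_eq_reg_l with (f1 * f1 + f2 * f2); [|lra].
    transitivity (f2 * (f1 * p1 + f2 * p2) + f1 * (- f2 * p1 + f1 * p2)); [ring|].
    rewrite E1, E2; ring.
Qed.

(** A nonzero [f] and its perpendicular separate points, so the lexicographic maximum is strict. *)
Lemma lex_exposed_perp (n : nat) (pos : nat -> hpoint) (f : hpoint) (u : nat) :
  inj_on_vertices n pos -> (u < n)%nat -> 0 < knorm2 f ->
  (forall x, (x < n)%nat -> kdot f (pos x) <= kdot f (pos u) /\
     (kdot f (pos x) = kdot f (pos u) ->
      kdot (- snd f, fst f) (pos x) <= kdot (- snd f, fst f) (pos u))) ->
  exists h, exposed n pos h u.
Proof.
  intros Hinj Hu Hf H; apply (lex_exposed n pos f (- snd f, fst f)).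
  intros x Hx Hxu; destruct (H x Hx) as [H1 H2]; split; auto; intros E.
  destruct (Rle_lt_or_eq_dec _ _ (H2 E)) as [|E2]; auto.
  exfalso; apply Hxu, Hinj; auto; apply (kdot_perp_eq f); auto.
Qed.

(* Seen from the exposed vertex [a], the extreme direction is found by maximizing the slope
   relative to [f]; the farthest vertex in that direction is exposed. *)
Lemma sector_end (n : nat) (pos : nat -> hpoint) (f : hpoint) (a : nat) (sg : R) :
  inj_on_vertices n pos -> (2 <= n)%nat -> (a < n)%nat -> exposed n pos f a -> sg * sg = 1 ->
  exists b h, (b < n)%nat /\ b <> a /\ exposed n pos h b /\
    forall x, (x < n)%nat -> 0 <= sg * det3 (pos a) (pos b) (pos x) /\
      (det3 (pos a) (pos b) (pos x) = 0 -> kdot f (pos b) <= kdot f (pos x)).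
Proof.
  intros Hinj Hn Ha Hf Hsg.
  set (phi := fun x => kdot f (pos a) - kdot f (pos x)).
  set (g := fun x => sg * (kdot (- snd f, fst f) (pos x) - kdot (- snd f, fst f) (pos a))).
  assert (Hphi : forall x, (x < n)%nat -> x <> a -> 0 < phi x).
  { intros x Hx Hxa; pose proof (Hf x Hx Hxa); unfold phi; lra. }
  destruct (lex_max (fun x => x <> a) (fun x => g x / phi x) phi n) as (b & Hb & Hba & Hmax).
  { destruct (Nat.eq_dec a 0) as [->|]; [exists 1%nat|exists 0%nat]; split; lia. }
  pose proof (knorm2_pos_exposed n pos f a b Hf Hb Hba) as Hff.
  pose proof (Hphi b Hb Hba) as Pb.
  set (S := g b / phi b) in *.
  assert (Sg : g b = S * phi b) by (unfold S; field; lra).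
  assert (Hle : forall x, (x < n)%nat -> x <> a -> g x <= S * phi x /\ (g x = S * phi x -> phi x <= phi b)).
  { intros x Hx Hxa; destruct (Hmax x Hx Hxa) as [M1 M2]; pose proof (Hphi x Hx Hxa) as Px.
    assert (Gx : g x = g x / phi x * phi x) by (field; lra).
    split; [rewrite Gx; apply Rmult_le_compat_r; lra|].
    intros E; apply M2; apply Rmult_eq_reg_r with (phi x); lra. }
  (* Comparing slopes [g / phi] amounts to comparing orientations at [a]. *)
  assert (Hdet : forall x, sg * det3 (pos a) (pos b) (pos x) * knorm2 f = g b * phi x - g x * phi b).
  { intros x; unfold g, phi, det3, knorm2, kdot; simpl; ring. }
  (* Relative to [a], the functional [h] is [g - S phi]: it is maximal exactly on the extreme ray
     through [b]. The tie-breaker [- f] picks the farthest vertex on that ray. *)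
  set (h := (- (sg * snd f) + S * fst f, sg * fst f + S * snd f)).
  assert (Hh : forall x, kdot h (pos x) = kdot h (pos a) + (g x - S * phi x)).
  { intros x; unfold h, g, phi, kdot; simpl; ring. }
  destruct (lex_exposed n pos h (- fst f, - snd f) b) as [h' Hh'].
  { intros x Hx Hxb.
    assert (Ek : forall y, kdot (- fst f, - snd f) (pos y) = phi y - kdot f (pos a)).
    { intros y; unfold phi, kdot; simpl; ring. }
    rewrite (Hh x), (Hh b), !Ek.
    destruct (Nat.eq_dec x a) as [->|Hxa].
    - assert (Za : phi a = 0) by (unfold phi; ring).
      assert (Zg : g a = 0) by (unfold g; ring).
      rewrite Za, Zg, Sg; split; lra.
    - destruct (Hle x Hx Hxa) as [L1 L2]; split; [lra|intros E].
      assert (E1 : g x = S * phi x) by lra.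
      destruct (Rle_lt_or_eq_dec _ _ (L2 E1)) as [|E2]; [lra|].
      exfalso; apply Hxb, Hinj; auto; apply (kdot_perp_eq f); auto.
      + unfold phi in E2; lra.
      + assert (E3 : g x = g b) by (rewrite E1, Sg, E2; reflexivity).
        unfold g in E3; apply Rmult_eq_reg_l with sg; [lra|intros Z; rewrite Z in Hsg; lra]. }
  exists b, h'; repeat split; auto.
  - destruct (Nat.eq_dec x a) as [->|Hxa]; [right; unfold det3; ring|].
    apply Rmult_le_reg_r with (knorm2 f); auto.
    rewrite Hdet, Sg; destruct (Hle x H Hxa); nra.
  - intros E; destruct (Nat.eq_dec x a) as [->|Hxa]; [unfold phi in Pb; lra|].
    destruct (Hle x H Hxa) as [L1 L2].
    pose proof (Hdet x) as D; rewrite E in D.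
    assert (E1 : g x = S * phi x).
    { apply Rmult_eq_reg_r with (phi b); [|lra]. rewrite Sg in D; lra. }
    specialize (L2 E1); unfold phi in L2; lra.
Qed.

Lemma collinear_on_seg (f a b x : hpoint) : det3 a b x = 0 ->
  kdot f b < kdot f a -> kdot f b <= kdot f x <= kdot f a -> on_seg x a b.
Proof.
  intros H Hb Hx.
  set (P := kdot f a - kdot f b); set (t := (kdot f a - kdot f x) / P).
  assert (HP : 0 < P) by (unfold P; lra).
  assert (Et : t * P = kdot f a - kdot f x) by (unfold t; field; lra).
  exists t; split.
  - unfold P in *; split; [apply Rmult_le_reg_r with P|apply Rmult_le_reg_r with P]; unfold P; lra.
  - destruct x as [x1 x2]; unfold seg_pt; simpl.
    unfold det3, kdot in *; simpl in *; f_equal; apply Rmult_eq_reg_r with P; try lra.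
    + transitivity (fst a * P + t * P * (fst b - fst a)); [rewrite Et|ring].
      unfold P; apply Rminus_diag_uniq.
      transitivity (snd f * ((fst b - fst a) * (x2 - snd a) - (snd b - snd a) * (x1 - fst a)));
        [ring|rewrite H; ring].
    + transitivity (snd a * P + t * P * (snd b - snd a)); [rewrite Et|ring].
      unfold P; apply Rminus_diag_uniq.
      transitivity (- fst f * ((fst b - fst a) * (x2 - snd a) - (snd b - snd a) * (x1 - fst a)));
        [ring|rewrite H; ring].
Qed.

Lemma outer_triangle (n : nat) (G : graph) (pos : nat -> hpoint) :
  (4 <= n)%nat -> maximal_planar n G -> straight_drawing n G pos ->
  exists a b c f, (a < n)%nat /\ (b < n)%nat /\ (c < n)%nat /\ exposed n pos f a /\
    G a b /\ G b c /\ G c a /\ det3 (pos a) (pos b) (pos c) <> 0 /\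
    forall x, (x < n)%nat -> in_triangle (pos a) (pos b) (pos c) (pos x).
Proof.
  intros Hn Hmp Hd; pose proof Hd as (Hinj & Hcross & Hvx).
  (* Any exposed vertex would do for [a]; [(- 0, 1)] is the perpendicular of [(1, 0)] in the form
     [(- snd f, fst f)]. *)
  destruct (lex_max (fun _ => True) (fun x => kdot (1, 0) (pos x)) (fun x => kdot (- 0, 1) (pos x)) n)
    as (a & Ha & _ & Hmax); [exists 0%nat; split; [lia|exact I]|].
  destruct (lex_exposed_perp n pos (1, 0) a Hinj Ha) as (f & Hf).
  { unfold knorm2, kdot; simpl; lra. }
  { intros x Hx; apply Hmax; auto. }
  clear Hmax.
  destruct (sector_end n pos f a 1 Hinj ltac:(lia) Ha Hf ltac:(lra)) as (b & fb & Hb & Hba & Eb & Sb).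
  destruct (sector_end n pos f a (-1) Hinj ltac:(lia) Ha Hf ltac:(lra)) as (c & fc & Hc & Hca & Ec & Sc).
  assert (Gab : G a b) by (apply (exposed_adjacent n G pos f fb); auto).
  assert (Gca : G c a) by (apply (exposed_adjacent n G pos fc f); auto).
  pose proof (Hf b Hb Hba) as Fb; pose proof (Hf c Hc Hca) as Fc.
  destruct (Sb c Hc) as [Dbc _].
  (* If both extreme rays coincide, all vertices lie on one line with [a] and [b] at the ends, and a
     third vertex would lie on the edge [a b]. *)
  destruct (Req_dec (det3 (pos a) (pos b) (pos c)) 0) as [D0|D0].
  { exfalso.
    assert (exists x, (x < n)%nat /\ x <> a /\ x <> b) as (x & Hx & Hxa & Hxb).
    { destruct (Nat.eq_dec a 0), (Nat.eq_dec b 0), (Nat.eq_dec a 1), (Nat.eq_dec b 1); subst;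
      first [exists 0%nat; lia|exists 1%nat; lia|exists 2%nat; lia]. }
    destruct (Sb x Hx) as [X1 X2]; destruct (Sc x Hx) as [Y1 _].
    pose proof (Hf x Hx Hxa) as Fx.
    assert (Hk : det3 (pos a) (pos c) (pos x) * (kdot f (pos a) - kdot f (pos b)) =
                 det3 (pos a) (pos b) (pos x) * (kdot f (pos a) - kdot f (pos c))).
    { apply Rminus_diag_uniq.
      transitivity (det3 (pos a) (pos b) (pos c) * (kdot f (pos x) - kdot f (pos a)));
        [unfold det3, kdot; ring|rewrite D0; ring]. }
    assert (Dx : det3 (pos a) (pos b) (pos x) = 0).
    { apply Rle_antisym; [|lra]. nra. }
    apply (Hvx a b x Gab Hx Hxa Hxb), (collinear_on_seg f); auto.
    specialize (X2 Dx); lra. }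
  set (D := det3 (pos a) (pos b) (pos c)) in *.
  assert (HD : 0 < D) by lra.
  assert (Hbc : b <> c) by (intros ->; apply D0; unfold D, det3; ring).
  assert (Gbc : G b c) by (apply (exposed_adjacent n G pos fb fc); auto).
  assert (B2 : forall x, (x < n)%nat -> 0 <= bary (pos b) (pos c) (pos a) (pos x)).
  { intros x Hx; unfold bary; rewrite (det3_rot (pos a) (pos b) (pos c)); fold D; destruct (Sc x Hx) as [Y _].
    apply Rmult_le_pos; [unfold det3 in *; lra|apply Rlt_le, Rinv_0_lt_compat; auto]. }
  assert (B3 : forall x, (x < n)%nat -> 0 <= bary (pos c) (pos a) (pos b) (pos x)).
  { intros x Hx; unfold bary; rewrite (det3_rot (pos b) (pos c) (pos a)), (det3_rot (pos a) (pos b) (pos c)); fold D.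
    destruct (Sb x Hx) as [Y _].
    apply Rmult_le_pos; [unfold det3 in *; lra|apply Rlt_le, Rinv_0_lt_compat; auto]. }
  exists a, b, c, f; repeat (split; [solve [auto]|]).
  intros x Hx; split; [|auto]; apply Rnot_lt_le; intros Hneg.
  (* a vertex beyond the side bc yields an exposed vertex d such that the edges ad and bc cross *)
  set (h := (snd (pos c) - snd (pos b), fst (pos b) - fst (pos c))).
  assert (Hh : forall y, det3 (pos y) (pos b) (pos c) = kdot h (pos b) - kdot h (pos y)).
  { intros y; unfold h, det3, kdot; simpl; ring. }
  destruct (lex_max (fun _ => True) (fun x => kdot h (pos x)) (fun x => kdot (- snd h, fst h) (pos x)) n)
    as (d & Hdn & _ & Hmax); [exists x; auto|].
  destruct (lex_exposed_perp n pos h d Hinj Hdn) as (fd & Ed).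
  { pose proof (Hh a) as H; unfold D in HD.
    unfold knorm2, kdot in *.
    destruct (Req_dec (fst h) 0) as [Z1|]; [destruct (Req_dec (snd h) 0) as [Z2|]|]; [|nra|nra].
    rewrite Z1, Z2 in H; lra. }
  { intros y Hy; apply Hmax; auto. }
  assert (Dd : det3 (pos d) (pos b) (pos c) < 0).
  { destruct (Hmax x Hx I) as [M _]; rewrite Hh.
    assert (det3 (pos x) (pos b) (pos c) < 0).
    { apply Rnot_le_lt; intros N; apply (Rlt_not_le _ _ Hneg); unfold bary; fold D.
      apply Rmult_le_pos; [auto|apply Rlt_le, Rinv_0_lt_compat; auto]. }
    rewrite Hh in *; lra. }
  assert (Had : a <> d) by (intros ->; unfold D in HD; lra).
  assert (Hbd : b <> d) by (intros ->; unfold det3 in Dd; lra).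
  assert (Hcd : c <> d) by (intros ->; unfold det3 in Dd; lra).
  assert (Gad : G a d) by (apply (exposed_adjacent n G pos f fd); auto).
  (* The segment [a d] crosses the line [b c] at parameter [D / T], where the affine function with
     values [D] at [a] and [D - T] at [d] vanishes. *)
  set (T := D - det3 (pos d) (pos b) (pos c)).
  assert (HT : 0 < T) by (unfold T; lra).
  set (p := seg_pt (pos a) (pos d) (D / T)).
  assert (Ht : 0 <= D / T <= 1).
  { split; [apply Rmult_le_pos; [lra|apply Rlt_le, Rinv_0_lt_compat; auto]|].
    apply Rmult_le_reg_r with T; auto; replace (D / T * T) with D by (field; lra); unfold T; lra. }
  assert (P1 : bary (pos a) (pos b) (pos c) p = 0).
  { unfold p; rewrite bary_seg; unfold bary; fold D.
    replace (det3 (pos d) (pos b) (pos c)) with (D - T) by (unfold T; ring); field; split; lra. }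
  assert (P2 : forall y z w, (forall x, (x < n)%nat -> 0 <= bary y z w (pos x)) -> 0 <= bary y z w p).
  { intros y z w H; unfold p; rewrite bary_seg; pose proof (H a Ha); pose proof (H d Hdn); nra. }
  assert (Ob : on_seg p (pos b) (pos c)).
  { apply (bary_zero_on_seg (pos a)); auto; repeat split; auto; rewrite P1; lra. }
  assert (Oa : on_seg p (pos a) (pos d)) by (exists (D / T); split; auto).
  destruct (Hcross a d b c p Gad Gbc) as (v & V1 & V2 & _); auto;
    [unfold same_edge; lia|destruct V1, V2; subst; auto].
Qed.

(** * From the resolution to pointwise distances *)

(** [real] sends an infinite bound to 0, a value excluded by [0 < r]; hence the infimum is finite
    and is a lower bound. The same holds for the outer infimum in [resolution_le]. *)
Lemma dist_to_seg_le (r : R) (p a b q : hpoint) :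
  0 < r -> r <= dist_to_seg p a b -> on_seg q a b -> r <= hdist p q.
Proof.
  unfold dist_to_seg; intros Hr H Hq.
  destruct (Glb_Rbar_correct (fun d => exists q, on_seg q a b /\ d = hdist p q)) as [L _].
  specialize (L (hdist p q) (ex_intro _ q (conj Hq eq_refl))).
  destruct (Glb_Rbar _) as [x| |]; simpl in *; lra.
Qed.

Lemma resolution_le (n : nat) (G : graph) (pos : nat -> hpoint) (v i j : nat) (q : hpoint) :
  0 < vertex_edge_resolution n G pos -> (v < n)%nat -> G i j -> v <> i -> v <> j ->
  on_seg q (pos i) (pos j) -> vertex_edge_resolution n G pos <= hdist (pos v) q.
Proof.
  intros Hr Hv Gij Vi Vj Hq; apply (dist_to_seg_le _ (pos v) (pos i) (pos j)); auto.
  unfold vertex_edge_resolution in *.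
  match type of Hr with 0 < real (Glb_Rbar ?E) =>
    destruct (Glb_Rbar_correct E) as [L _];
    assert (HE : E (dist_to_seg (pos v) (pos i) (pos j))) by (exists v, i, j; auto)
  end.
  specialize (L _ HE).
  destruct (Glb_Rbar _) as [x| |]; simpl in *; lra.
Qed.

Theorem theorem1 :
  exists C : R, 0 < C /\
    forall (n : nat) (G : graph), (4 <= n)%nat -> maximal_planar n G ->
    forall pos : nat -> hpoint, hyp_drawing n G pos ->
      vertex_edge_resolution n G pos <= C / sqrt (INR n).
Proof.
  (* For [n >= 4], [n / 4 <= n - 3 <= 384 / r^2], so [r^2 n <= 1536 < 40^2]. *)
  exists 40; split; [lra|].
  intros n G Hn Hmp pos (Hdisk & Hd).
  assert (Hst : straight_drawing n G pos) by exact Hd.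
  assert (HnR : 4 <= INR n) by (apply le_INR in Hn; simpl in Hn; lra).
  assert (Hsq : 0 < sqrt (INR n)) by (apply sqrt_lt_R0; lra).
  assert (Hss : sqrt (INR n) * sqrt (INR n) = INR n) by (apply sqrt_sqrt; lra).
  set (r := vertex_edge_resolution n G pos).
  apply Rnot_lt_le; intros Hlt.
  assert (Hr : 0 < r).
  { apply Rlt_trans with (40 / sqrt (INR n)); auto; apply Rdiv_lt_0_compat; lra. }
  destruct (outer_triangle n G pos Hn Hmp Hst)
    as (a & b & c & f & Ha & Hb & Hc & Hf & Gab & Gbc & Gca & HD & Hin).
  set (l := filter (fun v => negb (orb (Nat.eqb v a) (orb (Nat.eqb v b) (Nat.eqb v c)))) (seq 0 n)).
  assert (Hl : forall v, In v l <-> (v < n)%nat /\ v <> a /\ v <> b /\ v <> c).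
  { intros v; unfold l; rewrite filter_In, in_seq.
    destruct (Nat.eqb_spec v a), (Nat.eqb_spec v b), (Nat.eqb_spec v c); simpl;
    intuition (try congruence; try lia). }
  assert (Hlen : (n <= 3 + length l)%nat).
  { rewrite <- (length_seq n 0) at 1; change (3 + length l)%nat with (length (a :: b :: c :: l)).
    apply NoDup_incl_length; [apply seq_NoDup|].
    intros v Hv; apply in_seq in Hv; simpl; rewrite Hl; lia. }
  assert (Hpack : INR (length l) <= 384 / (r * r)).
  { apply (triangle_packing (pos a) (pos b) (pos c) pos); auto.
    - apply NoDup_filter, seq_NoDup.
    - intros v Hv; apply Hl in Hv; split; [apply Hdisk|apply Hin]; tauto.
    - intros v q Hv Hq; apply Hl in Hv; destruct Hv as (Hv & V1 & V2 & V3).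
      destruct Hq as [Hq|[Hq|Hq]];
        [apply (resolution_le n G pos v a b)|apply (resolution_le n G pos v b c)
        |apply (resolution_le n G pos v c a)]; auto.
    (* An edge from [u] to some [x <> v] has [u] as an endpoint and is at distance at least [r] from
       [v]; likewise with [u] and [v] exchanged. If no such edge existed, [u] and [v] would have no
       neighbours but each other. *)
    - intros u v Hu Hv Huv; apply Hl in Hu, Hv.
      destruct Hu as (Hu & U1 & U2 & U3), Hv as (Hv & V1 & V2 & V3).
      apply NNPP; intros Hlow.
      apply (no_isolated_pair n G pos f a u v); auto; intros x Gx; apply NNPP; intros Nx; apply Hlow.
      + replace (hdist (pos u) (pos v)) with (hdist (pos v) (pos u)).
        * apply (resolution_le n G pos v u x); auto; apply on_seg_l.
        * unfold hdist, kdot; do 2 f_equal; [ring|f_equal; ring].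
      + apply (resolution_le n G pos u v x); auto; apply on_seg_l. }
  apply le_INR in Hlen; rewrite plus_INR in Hlen; simpl in Hlen.
  assert (Hrs : 40 < r * sqrt (INR n)).
  { replace 40 with (40 / sqrt (INR n) * sqrt (INR n)) by (field; lra).
    apply Rmult_lt_compat_r; auto. }
  assert (Hr2 : 1600 < r * r * INR n).
  { rewrite <- Hss; replace (r * r * (sqrt (INR n) * sqrt (INR n)))
      with (r * sqrt (INR n) * (r * sqrt (INR n))) by ring; nra. }
  assert (Hm : INR (length l) * (r * r) <= 384).
  { replace 384 with (384 / (r * r) * (r * r)) by (field; lra).
    apply Rmult_le_compat_r; nra. }
  assert (r * r * (INR n / 4) <= r * r * INR (length l)) by (apply Rmult_le_compat_l; nra).
  lra.
Qed.
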